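(* Let $u\in H^2(S^1)$ with $u>0$. Then $$\int_0^{2\pi}\Big(u_{\theta\theta}^2-\tfrac52u_\theta^2+\tfrac{9}{16}u^2\Big)\,d\theta\ \left(\int_0^{2\pi}u^{-2/3}(\theta)\,d\theta\right)^3\ \ge\ 9\pi^4,$$ and equality holds if and only if $$u(\theta)=c\left(\lambda^2\cos^2\frac{\theta-\alpha}{2}+\lambda^{-2}\sin^2\frac{\theta-\alpha}{2}\right)^{3/2}$$ for some $\lambda,c>0$ and $\alpha\in[0,2\pi)$.
   Context: $S^1$ is the unit circle, parametrized by the angle $\theta\in[0,2\pi]$; functions on $S^1$ are identified with $2\pi$-periodic functions of $\theta$, and subscripts $\theta$ denote derivatives in $\theta$. $H^2(S^1)$ is the usual Sobolev space; $u>0$ means $u$ is positive everywhere. *)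

(* Defs.v *)
From HB Require Import structures.
From mathcomp Require Import all_boot all_order all_algebra.
From mathcomp Require Import all_classical all_reals all_analysis.

Set Implicit Arguments.
Unset Strict Implicit.
Unset Printing Implicit Defensive.

Import Order.TTheory GRing.Theory Num.Theory.
Import numFieldNormedType.Exports.

Local Open Scope classical_set_scope.
Local Open Scope ring_scope.

(* Functions on S^1 are 2 * pi - periodic functions of the angle; integrals over
   S^1 are Lebesgue integrals over one period. *)
Definition circle (R : realType) : set R := `[0, 2 * pi].

Definition circle_test (R : realType) (phi : R -> R) : Prop :=
  periodic phi (2 * pi) /\
  (forall (k : nat) (x : R), derivable (derive1n k phi) x 1).

Definition circle_L2 (R : realType) (f : R -> R) : Prop :=
  [/\ periodic f (2 * pi), measurable_fun (@circle R) f &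
      (@lebesgue_measure R).-integrable (@circle R)
        (fun x => (f x ^+ 2)%:E)].

Definition weak_derivative (R : realType) (k : nat) (u v : R -> R) : Prop :=
  forall phi : R -> R, circle_test phi ->
    \int[@lebesgue_measure R]_(x in @circle R) (u x * derive1n k phi x) =
    (-1) ^+ k * \int[@lebesgue_measure R]_(x in @circle R) (v x * phi x).

(* u belongs to H^2(S^1) and u1, u2 are representatives of its first and second
   weak derivatives.  An element of H^2(S^1) is a class modulo a.e. equality
   containing a unique continuous function; u is that function, so that
   pointwise statements about u (such as u > 0 everywhere) make sense. *)
Definition sobolev_H2 (R : realType) (u u1 u2 : R -> R) : Prop :=
  [/\ continuous u, circle_L2 u, circle_L2 u1 & circle_L2 u2] /\
  (weak_derivative 1 u u1 /\ weak_derivative 2 u u2).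

(* Main.v *)
(* Write u = b^3 and kappa = b'' + b / 4. Up to the derivative of a periodic
   function, the first integrand is 9 b^4 kappa^2. In the variable s with
   ds = b^-2 dtheta, the functions cos (theta / 2) / b and sin (theta / 2) / b
   solve Hill's equation y_ss + p y = 0 with p = b^3 kappa, and they are
   antiperiodic. The product F is invariant under scaling of u, so the s-length
   of the circle may be taken to be pi; the claim is then that the integral of
   p^2 ds is at least pi.

   Choose the basis of solutions cos s + z1, sin s + z2 with z1, z2 orthogonal to
   cos s and sin s. Testing the equation against cos s, sin s, z1, z2 gives, with m
   the mean of p, A the integral of |z_s|^2 and zeta = z1 cos s + z2 sin s,
     pi (1 - m) = int p zeta ds = A - int p |z|^2 ds.
   An antiperiodic z orthogonal to cos s, sin s satisfies
   z^2 <= (pi / 4 - 2 / pi) int z_s^2 ds pointwise, where pi (pi / 4 - 2 / pi) < 1 / 2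
   because pi^2 < 10. If int p^2 ds <= pi, this bound and Cauchy-Schwarz for
   int (p - m) zeta ds force m = 1 and A = 0. Then cos s and sin s themselves are
   solutions, so b^2 is a quadratic form in cos (theta / 2), sin (theta / 2).
   Conversely, for such b the function p is constant, and equal to 1 because
   sin (theta / 2) / b has no zero inside the period. *)

Require Import Defs.
From HB Require Import structures.
From mathcomp Require Import all_boot all_order all_algebra.
From mathcomp Require Import all_classical all_reals all_analysis.
From mathcomp Require Import measurable_realfun ring lra.

Set Implicit Arguments.
Unset Strict Implicit.
Unset Printing Implicit Defensive.

Import Order.TTheory GRing.Theory Num.Theory.
Import numFieldNormedType.Exports.

Local Open Scope classical_set_scope.
Local Open Scope ring_scope.

(** If A > 0, the form at (B, A) equals A (A C - B^2); if A = 0, its value - B^2 (C + 2) at (C + 1,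
    B) forces B = 0. Used for Cauchy-Schwarz and for the pointwise bound on antiperiodic
    functions. *)
Lemma quad_form_discr (R : realFieldType) (A B C : R) :
  (forall s t, 0 <= s ^+ 2 * A - 2 * s * t * B + t ^+ 2 * C) -> B ^+ 2 <= A * C.
Proof.
move=> quad; have A0 : 0 <= A by have := quad 1 0; lra.
have [A00|An0] := eqVneq A 0; last first.
  have : 0 < A by rewrite lt_def An0.
  move=> Ap; have := quad B A.
  rewrite [leRHS](_ : _ = A * (A * C - B ^+ 2)); last by ring.
  by rewrite pmulr_rge0// subr_ge0.
have C0 : 0 <= C by have := quad 0 1; lra.
have := quad (C + 1) B; rewrite A00.
rewrite [leRHS](_ : _ = - (B ^+ 2 * (C + 2))); last by ring.
rewrite oppr_ge0 mul0r pmulr_lle0//; lra.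
Qed.

(** * Absolutely continuous functions on the period *)

Section integrability.
Context {R : realType}.
Notation T := (2 * pi).
Notation mu := (@lebesgue_measure R).
Implicit Types (f g F G : R -> R) (t : R).

Definition cts f := {within `[0, T], continuous f}.
Definition intg f := mu.-integrable `[0, T] (EFin \o f).
Definition L2 f :=
  measurable_fun `[0, T] f /\ mu.-integrable `[0, T] (fun x => (f x ^+ 2)%:E).
Definition prim f (t : R) : R := \int[mu]_(x in `[0, t]) f x.

Lemma T_gt0 : 0 < T :> R.
Proof. by rewrite mulr_gt0// pi_gt0. Qed.

Let m0T : measurable (`[0, T]%classic : set (measurableTypeR R)).
Proof. exact: measurable_itv. Qed.

Lemma itv0T_0 : `[0, T]%classic (0 : R).
Proof. by rewrite /= in_itv/= lexx ltW// T_gt0. Qed.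

Lemma itv0T_T : `[0, T]%classic (T : R).
Proof. by rewrite /= in_itv/= lexx ltW// T_gt0. Qed.

Lemma ctsP f : cts f <->
  (forall x, `[0, T]%classic x -> f @ within `[0, T] (nbhs x) --> f x).
Proof. by split => /subspace_continuousP. Qed.

Lemma continuous_cts f : continuous f -> cts f.
Proof. exact: continuous_subspaceT. Qed.

Lemma cts_cst (c : R) : cts (fun=> c).
Proof. by apply: continuous_cts => x; exact: cvg_cst. Qed.

Lemma ctsD f g : cts f -> cts g -> cts (fun x => f x + g x).
Proof.
by move=> /ctsP cf /ctsP cg; apply/ctsP => x xT; apply: cvgD; [exact: cf|exact: cg].
Qed.

Lemma ctsN f : cts f -> cts (fun x => - f x).
Proof. by move=> /ctsP cf; apply/ctsP => x xT; apply: cvgN; exact: cf. Qed.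

Lemma ctsB f g : cts f -> cts g -> cts (fun x => f x - g x).
Proof. by move=> cf cg; apply: ctsD => //; exact: ctsN. Qed.

Lemma ctsM f g : cts f -> cts g -> cts (fun x => f x * g x).
Proof.
by move=> /ctsP cf /ctsP cg; apply/ctsP => x xT; apply: cvgM; [exact: cf|exact: cg].
Qed.

Lemma ctsX f n : cts f -> cts (fun x => f x ^+ n).
Proof.
move=> cf; elim: n => [|n ih]; first by under eq_fun do rewrite expr0; exact: cts_cst.
by under eq_fun do rewrite exprS; exact: ctsM.
Qed.

Lemma cts_comp (h : R -> R) f : cts f ->
  (forall x, `[0, T]%classic x -> {for f x, continuous h}) ->
  cts (fun x => h (f x)).
Proof.
move=> /ctsP cf ch; apply/ctsP => x xT.
by apply: (cvg_comp _ _ (cf _ xT)); exact: ch.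
Qed.

Lemma ctsV f : cts f -> (forall x, `[0, T]%classic x -> f x != 0) ->
  cts (fun x => (f x)^-1).
Proof.
by move=> /ctsP cf f0; apply/ctsP => x xT; apply: cvgV; [exact: f0|exact: cf].
Qed.

Lemma cts_ext f g : (forall x, `[0, T]%classic x -> f x = g x) -> cts f -> cts g.
Proof.
move=> fg /ctsP cf; apply/ctsP => x xT.
have -> : g x = f x by rewrite fg.
apply: cvg_trans (cf _ xT); apply: near_eq_cvg.
by rewrite near_withinE; near=> y => yT; rewrite fg.
Unshelve. all: by end_near. Qed.

Lemma cts_bounded f : cts f ->
  exists2 M, 0 < M & forall x, `[0, T]%classic x -> `|f x| <= M.
Proof.
move=> cf; have := continuous_compact cf (@segment_compact _ 0 (2 * pi)).
move=> /compact_bounded[M [_ mrt]].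
exists (`|M| + 1); first by rewrite ltr_wpDl.
move=> x xT; apply: mrt; last by exists x.
by rewrite (le_lt_trans (ler_norm M)) // ltrDl.
Qed.

Lemma cts_measurable f : cts f -> measurable_fun `[0, T] f.
Proof. by move=> cf; apply: subspace_continuous_measurable_fun. Qed.

Lemma cts_intg f : cts f -> intg f.
Proof. by move=> cf; apply: continuous_compact_integrable => //; exact: segment_compact. Qed.

Lemma intg_ext f g : (forall x, `[0, T]%classic x -> f x = g x) -> intg f -> intg g.
Proof.
move=> fg; apply: eq_integrable => // x; rewrite inE => xT /=.
by rewrite fg.
Qed.

Lemma intgD f g : intg f -> intg g -> intg (fun x => f x + g x).
Proof.
move=> cf cg; have := integrableD m0T cf cg.
by apply: eq_integrable.
Qed.

Lemma intgZ (c : R) f : intg f -> intg (fun x => c * f x).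
Proof.
move=> cf; have := integrableZl m0T c cf.
by apply: eq_integrable.
Qed.

Lemma intgN f : intg f -> intg (fun x => - f x).
Proof.
move=> cf; have := integrableN cf.
by apply: eq_integrable.
Qed.

Lemma intgB f g : intg f -> intg g -> intg (fun x => f x - g x).
Proof. by move=> cf cg; apply: intgD => //; exact: intgN. Qed.

Lemma intg_ctsM f g : cts f -> intg g -> intg (fun x => f x * g x).
Proof.
move=> cf ig; have [M M0 fM] := cts_bounded cf.
have := @integrableMr _ _ _ mu _ m0T f (EFin \o g).
move=> /(_ (cts_measurable cf)) H.
have : mu.-integrable `[0, T] ((EFin \o f) \* (EFin \o g))%E.
  apply: H => //; exists M; split; first by rewrite num_real.
  by move=> y My x xT; apply: (le_trans (fM _ xT)); exact: ltW.
exact: eq_integrable.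
Qed.

Lemma L2_intgM f g : L2 f -> L2 g -> intg (fun x => f x * g x).
Proof.
move=> [mf if2] [mg ig2].
have H : mu.-integrable `[0, T] (fun x => (f x ^+ 2)%:E + (g x ^+ 2)%:E)%E.
  by apply: integrableD.
apply: (le_integrable _ _ _ H) => //.
  by apply/measurable_EFinP; exact: measurable_funM.
move=> x _ /=; rewrite lee_fin [X in _ <= X]ger0_norm; last by rewrite addr_ge0 ?sqr_ge0.
rewrite ler_norml; nra.
Qed.

Lemma L2_intg_sq f : L2 f -> intg (fun x => f x ^+ 2).
Proof. by move=> []. Qed.

Lemma L2_cts f : cts f -> L2 f.
Proof.
move=> cf; split; first exact: cts_measurable.
by apply: cts_intg; exact: ctsX.
Qed.

Lemma L2_intg f : L2 f -> intg f.
Proof.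
move=> Lf; have := L2_intgM (L2_cts (@cts_cst 1)) Lf.
by apply: intg_ext => x _; rewrite mul1r.
Qed.

Lemma L2_ctsM f g : cts f -> L2 g -> L2 (fun x => f x * g x).
Proof.
move=> cf [mg ig2]; split.
  by apply: measurable_funM => //; exact: cts_measurable.
have := intg_ctsM (@ctsX _ 2 cf) ig2; apply: eq_integrable => // x _ /=.
by rewrite exprMn.
Qed.

Lemma L2D f g : L2 f -> L2 g -> L2 (fun x => f x + g x).
Proof.
move=> Lf Lg; split; first by apply: measurable_funD; [exact: Lf.1|exact: Lg.1].
have := intgD (intgD Lf.2 Lg.2) (@intgZ 2 _ (L2_intgM Lf Lg)).
by apply: eq_integrable => // x _ /=; congr (_%:E); ring.
Qed.

Lemma L2N f : L2 f -> L2 (fun x => - f x).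
Proof.
move=> Lf; split; first by apply: measurableT_comp => //; exact: Lf.1.
by have := Lf.2; apply: eq_integrable => // x _ /=; congr (_%:E); ring.
Qed.

Lemma L2B f g : L2 f -> L2 g -> L2 (fun x => f x - g x).
Proof. by move=> Lf Lg; apply: L2D => //; exact: L2N. Qed.

Lemma sub0t (t : R) : t <= T -> `[0, t]%classic `<=` `[0, T].
Proof. by move=> tT; apply: subset_itvl. Qed.

Lemma intg_sub f t : t <= T -> intg f -> mu.-integrable `[0, t] (EFin \o f).
Proof. by move=> tT; apply: integrableS => //; exact: sub0t. Qed.

Lemma primD f g t : t <= T -> intg f -> intg g ->
  prim (fun x => f x + g x) t = prim f t + prim g t.
Proof. by move=> tT fi gi; rewrite /prim RintegralD//; exact: intg_sub. Qed.

Lemma primB f g t : t <= T -> intg f -> intg g ->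
  prim (fun x => f x - g x) t = prim f t - prim g t.
Proof. by move=> tT fi gi; rewrite /prim RintegralB//; exact: intg_sub. Qed.

Lemma primZ (c : R) f t : t <= T -> intg f ->
  prim (fun x => c * f x) t = c * prim f t.
Proof. by move=> tT fi; rewrite /prim RintegralZl//; exact: intg_sub. Qed.

Lemma eq_prim f g t : t <= T -> (forall x, `[0, T]%classic x -> f x = g x) ->
  prim f t = prim g t.
Proof.
by move=> tT fg; apply: eq_Rintegral => x /set_mem /(sub0t tT) xT; exact: fg.
Qed.

Lemma le_prim f g t : t <= T -> intg f -> intg g ->
  (forall x, `[0, T]%classic x -> f x <= g x) -> prim f t <= prim g t.
Proof.
move=> tT fi gi fg; apply: le_Rintegral => //; [exact: intg_sub..|].
by move=> x /(sub0t tT); exact: fg.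
Qed.

Lemma prim_ge0 f t : t <= T -> (forall x, `[0, T]%classic x -> 0 <= f x) ->
  0 <= prim f t.
Proof. by move=> tT f0; apply: Rintegral_ge0 => x /(sub0t tT); exact: f0. Qed.

Lemma prim0 f : prim f 0 = 0.
Proof. by rewrite /prim set_itv1 Rintegral_set1. Qed.

Lemma prim_cst (c : R) t : 0 <= t -> prim (fun=> c) t = c * t.
Proof.
move=> t0; rewrite /prim Rintegral_cst//; congr (_ * _).
have mut : mu `[0, t] = t%:E.
  rewrite lebesgue_measure_itv/= lte_fin.
  case: ltP => [_|t0'] /=; first by rewrite sube0.
  by congr (_%:E); apply/eqP; rewrite eq_le t0 t0'.
by transitivity (fine t%:E) => //; congr fine.
Qed.

Lemma prim_cts f : intg f -> cts (prim f).
Proof. by move=> fi; apply: parameterized_integral_continuous => //; exact/ltW/T_gt0. Qed.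

(* F is absolutely continuous on [0, 2 pi] with density f. *)
Definition ac F f := intg f /\
  forall t, `[0, T]%classic t -> F t = F 0 + prim f t.

Lemma ac_prim f : intg f -> ac (prim f) f.
Proof. by move=> fi; split => // t _; rewrite prim0 add0r. Qed.

Lemma ac_cts F f : ac F f -> cts F.
Proof.
move=> [fi Ff]; apply: (@cts_ext (fun x => F 0 + prim f x)).
  by move=> x /Ff ->.
by apply: ctsD; [exact: cts_cst|exact: prim_cts].
Qed.

Lemma ac_ext F G f g : (forall x, `[0, T]%classic x -> F x = G x) ->
  (forall x, `[0, T]%classic x -> f x = g x) -> ac F f -> ac G g.
Proof.
move=> FG fg [fi Ff]; split; first exact: intg_ext fi.
move=> t tT; rewrite -!FG//; last exact: itv0T_0.
rewrite Ff//; congr (_ + _); apply: eq_prim => //.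
by move: tT; rewrite /= in_itv/= => /andP[].
Qed.

Lemma ac_prim_T F f : ac F f -> prim f T = F T - F 0.
Proof. by move=> [_ /(_ T itv0T_T) ->]; rewrite addrC addKr. Qed.

Lemma acD F G f g : ac F f -> ac G g ->
  ac (fun x => F x + G x) (fun x => f x + g x).
Proof.
move=> [fi Ff] [gi Gg]; split; first exact: intgD.
move=> t tT; rewrite Ff// Gg// primD//; first by ring.
by move: tT; rewrite /= in_itv/= => /andP[].
Qed.

Lemma acZ (c : R) F f : ac F f -> ac (fun x => c * F x) (fun x => c * f x).
Proof.
move=> [fi Ff]; split; first exact: intgZ.
move=> t tT; rewrite Ff// primZ//; first by ring.
by move: tT; rewrite /= in_itv/= => /andP[].
Qed.

Lemma acB F G f g : ac F f -> ac G g ->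
  ac (fun x => F x - G x) (fun x => f x - g x).
Proof.
move=> Ff /(@acZ (-1)) /(acD Ff); apply: ac_ext => x _; by rewrite mulN1r.
Qed.

Lemma ac_cst (c : R) : ac (fun=> c) (fun=> 0).
Proof.
split; first exact/cts_intg/cts_cst.
by move=> t; rewrite /= in_itv/= => /andP[t0 _]; rewrite prim_cst// mul0r addr0.
Qed.
End integrability.

(** * Derivatives, chain rule and approximation in L1 *)

Section fundamental_theorem.
Context {R : realType}.
Notation T := (2 * pi).
Notation mu := (@lebesgue_measure R).
Implicit Types (f g F G : R -> R) (t : R).

Lemma cts_interior f x : cts f -> 0 < x < T -> {for x, continuous f}.
Proof.
move=> /(continuous_within_itvP _ T_gt0)[cf _ _] x0T.
by apply: cf; rewrite in_itv.
Qed.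

(** Continuity up to the endpoints makes interior differentiability enough, so no one-sided
    derivatives at 0 and T appear. *)
Lemma ac_FTC F f : cts F -> cts f ->
  (forall x : R, 0 < x < T -> is_derive x 1 F (f x)) -> ac F f.
Proof.
move=> cF cf dF; split; first exact: cts_intg.
move=> t; rewrite /= in_itv/= => /andP[]; rewrite le_eqVlt => /predU1P[<- _|t0 tT].
  by rewrite prim0 addr0.
have sub : `[0, t] `<=` `[0, T] by exact: sub0t.
have H := @continuous_FTC2 R f F 0 t t0 (continuous_subspaceW sub cf).
rewrite /prim /Rintegral H.
- by rewrite -EFinB /= addrCA subrr addr0.
- have /(continuous_within_itvP _ t0)[_ F0 Ft] := continuous_subspaceW sub cF.
  split => // x; rewrite in_itv/= => /andP[x0 xt].
  by have [] : is_derive x 1 F (f x) by apply: dF; rewrite x0 (lt_le_trans xt).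
- move=> x; rewrite in_itv/= => /andP[x0 xt].
  have ? : is_derive x 1 F (f x) by apply: dF; rewrite x0 (lt_le_trans xt).
  by rewrite derive1E derive_val.
Qed.

Lemma ac_is_derive F f : ac F f -> cts f ->
  forall x : R, 0 < x < T -> is_derive x 1 F (f x).
Proof.
move=> [fi Ff] cf x xT; case/andP: (xT) => x0 xT'.
have [dp pf] := continuous_FTC1_closed xT' fi x0 (cts_interior cf xT).
have H : is_derive x 1 (prim f) (f x).
  by apply: DeriveDef; [exact: dp|rewrite -derive1E].
have H2 : is_derive x 1 (fun t => F 0 + prim f t) (f x).
  have -> : f x = 0 + f x by rewrite add0r.
  by apply: is_deriveD.
apply: (near_eq_is_derive _ H2).
have : x \in `]0, T[ by rewrite in_itv/=.
move/near_in_itvoo; apply: filterS => y; rewrite in_itv/= => /andP[y0 yT].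
by rewrite -Ff//= in_itv/= (ltW y0) ltW.
Qed.

(** The density [f] is taken continuous so that the rule reduces to the classical one; this covers
    [u], [b] and [prim rho], whose derivatives are continuous. *)
Lemma ac_comp (h h' : R -> R) F f : ac F f -> cts f ->
  (forall x, `[0, T]%classic x -> is_derive (F x) 1 h (h' (F x))) ->
  cts (fun x => h' (F x)) ->
  ac (fun x => h (F x)) (fun x => h' (F x) * f x).
Proof.
move=> Ff cf dh ch'; apply: ac_FTC.
- apply: cts_comp; first exact: ac_cts Ff.
  move=> x xT; apply/differentiable_continuous/derivable1_diffP.
  by have [] := dh x xT.
- exact: ctsM.
- move=> x xT; apply: is_derive1_comp; last exact: (ac_is_derive Ff cf).
  by apply: dh; rewrite /= in_itv/=; case/andP: xT => /ltW -> /ltW ->.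
Qed.

Lemma ac_smooth F f : (forall x : R, is_derive x 1 F (f x)) -> continuous f ->
  ac F f.
Proof.
move=> dF cf; apply: ac_FTC.
- apply: continuous_cts => x; apply/differentiable_continuous/derivable1_diffP.
  by have [] := dF x.
- exact: continuous_cts.
Qed.

Lemma intg_abs f : intg f -> intg (fun x => `|f x|).
Proof. by move=> fi; apply: integrable_norm. Qed.

Lemma prim_norm_le f t : `[0, T]%classic t -> intg f ->
  `|prim f t| <= prim (fun x => `|f x|) T.
Proof.
rewrite /= in_itv/= => /andP[t0 tT] fi.
apply: (@le_trans _ _ (prim (fun x => `|f x|) t)).
  by apply: le_normr_Rintegral => //; exact: intg_sub.
rewrite -subr_ge0 /prim Rintegral_itvB//; last exact: intg_abs.
exact: Rintegral_ge0.
Qed.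

Lemma intg_approx f (e : R) : intg f -> 0 < e ->
  exists2 h, continuous h & prim (fun x => `|f x - h x|) T <= e.
Proof.
move=> fi e0.
have muT : (mu `[0%R, T%R] < +oo)%E.
  by rewrite lebesgue_measure_itv/= lte_fin T_gt0 ltry.
have [g [cg gi]] := approximation_continuous_integrable (measurable_itv _) muT fi.
move=> /fine_cvgP[_ /cvgrPdist_le /(_ e e0)][N _ /(_ N (leqnn N))] /= H.
exists (g N) => //; move: H; rewrite sub0r normrN; apply: le_trans.
exact: ler_norm.
Qed.
End fundamental_theorem.

(** * The product rule for integrable densities *)

Section product_rule.
Context {R : realType}.
Notation T := (2 * pi).
Notation mu := (@lebesgue_measure R).
Implicit Types (f g F G a b : R -> R) (t : R).

(* The rule for continuous densities extends by density of these in L1, one factor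
   at a time. *)
Let prod_rule a b := forall t, `[0, T]%classic t ->
  prim (fun x => a x * prim b x + prim a x * b x) t = prim a t * prim b t.

Let prod_rule_continuous a b : continuous a -> continuous b -> prod_rule a b.
Proof.
move=> /continuous_cts ca /continuous_cts cb t tT.
have aa := ac_prim (cts_intg ca); have ab := ac_prim (cts_intg cb).
have [_ /(_ t tT)] :
    ac (fun x => prim a x * prim b x) (fun x => a x * prim b x + prim a x * b x).
  apply: ac_FTC.
  - by apply: ctsM; [exact: ac_cts aa|exact: ac_cts ab].
  - apply: ctsD; apply: ctsM => //; [exact: ac_cts ab|exact: ac_cts aa].
  - move=> x xT; have da := ac_is_derive aa ca xT.
    have db := ac_is_derive ab cb xT.
    apply: (is_derive_eq (is_deriveM da db)). by rewrite /GRing.scale/=; ring.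
by rewrite !prim0 mul0r add0r => ->.
Qed.

Lemma itvT_le t : `[0, T]%classic t -> t <= T.
Proof. by rewrite /= in_itv/= => /andP[]. Qed.

Let prod_rule_approx a b : intg a -> intg b ->
  (forall h, continuous h -> prod_rule h b) -> prod_rule a b.
Proof.
move=> ai bi H t tT; have tT' := itvT_le tT.
have [M M0 bM] := cts_bounded (prim_cts bi).
set N := prim (fun x => `|b x|) T.
have N0 : 0 <= N by apply: prim_ge0.
apply/eqP; rewrite -subr_eq0 -normr_eq0 eq_le normr_ge0 andbT.
apply/ler_addgt0Pr => e e0; rewrite add0r.
(* [M] bounds [prim b] and [N] is the L1 norm of [b]. The defect of the rule is bilinear and
   vanishes for (h, b), so it is the defect for (d, b) with d = a - h, whose three terms are at most
   M, N and M times the L1 norm of d. *)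
have C0 : 0 < M + N + M by rewrite -addrA ltr_pwDl// addr_ge0// ltW.
have [h ch hd] := intg_approx ai (divr_gt0 e0 C0).
set d := fun x => a x - h x.
have hi : intg h := cts_intg (continuous_cts ch).
have di : intg d by exact: intgB.
have dx x : `[0, T]%classic x -> `|prim d x| <= e / (M + N + M).
  by move=> xT; apply: le_trans hd; exact: prim_norm_le.
have i1 g : intg g -> intg (fun x => g x * prim b x).
  move=> gi; apply: (intg_ext _ (intg_ctsM (prim_cts bi) gi)) => x _.
  by rewrite mulrC.
have i2 g : intg g -> intg (fun x => prim g x * b x).
  by move=> gi; apply: intg_ctsM => //; exact: prim_cts.
have -> : prim (fun x => a x * prim b x + prim a x * b x) t - prim a t * prim b t =
    prim (fun x => d x * prim b x + prim d x * b x) t - prim d t * prim b t.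
  have := H h ch t tT; rewrite primD//; [|exact: i1|exact: i2].
  do 2 (rewrite primD//; [|by [exact: i1]|by [exact: i2]]).
  have -> : prim (fun x => d x * prim b x) t =
      prim (fun x => a x * prim b x) t - prim (fun x => h x * prim b x) t.
    rewrite -primB//; [|exact: i1|exact: i1].
    by apply: eq_prim => // x _; rewrite /d; ring.
  have -> : prim (fun x => prim d x * b x) t =
      prim (fun x => prim a x * b x) t - prim (fun x => prim h x * b x) t.
    rewrite -primB//; [|exact: i2|exact: i2].
    apply: eq_prim => // x xT; rewrite /d primB//; first by ring.
    exact: itvT_le.
  rewrite /d primB// mulrBl => <-; ring.
have dint : intg (fun x => d x * prim b x + prim d x * b x).
  by apply: intgD; [exact: i1|exact: i2].
apply: (le_trans (ler_normB _ _)); rewrite normrM.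
have -> : e = e / (M + N + M) * M + e / (M + N + M) * N + e / (M + N + M) * M.
  by rewrite -!mulrDr -mulrA mulVf ?mulr1// gt_eqF.
apply: lerD; last by apply: ler_pM => //; [exact: dx|exact: bM].
apply: (le_trans (prim_norm_le tT dint)).
apply: (@le_trans _ _ (prim (fun x => M * `|d x| + e / (M + N + M) * `|b x|) T)).
  apply: le_prim => //; first exact: intg_abs.
    by apply: intgD; apply: intgZ; exact: intg_abs.
  move=> x xT; apply: (le_trans (ler_normD _ _)); rewrite !normrM.
  apply: lerD; first by rewrite mulrC ler_wpM2r// bM.
  by rewrite ler_wpM2r// dx.
rewrite primD//; [|by apply: intgZ; exact: intg_abs..].
rewrite !primZ//; [|exact: intg_abs..].
by rewrite lerD2r mulrC ler_wpM2r// ltW.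
Qed.

Let prod_rule_intg a b : intg a -> intg b -> prod_rule a b.
Proof.
move=> ai bi; apply: prod_rule_approx => // h ch t tT.
have hi : intg h := cts_intg (continuous_cts ch).
have := @prod_rule_approx b h bi hi _ t tT.
rewrite [RHS]mulrC => <-; last by move=> k ck; exact: prod_rule_continuous.
by apply: eq_prim => [|x _]; [exact: itvT_le|ring].
Qed.

Lemma acM F G f g : ac F f -> ac G g ->
  ac (fun x => F x * G x) (fun x => f x * G x + F x * g x).
Proof.
move=> acF acG; have cF := ac_cts acF; have cG := ac_cts acG.
case: acF => fi Ff; case: acG => gi Gg.
have fGi : intg (fun x => f x * G x).
  by apply: (intg_ext _ (intg_ctsM cG fi)) => x _; rewrite mulrC.
have Fgi : intg (fun x => F x * g x) by exact: intg_ctsM.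
split; first exact: intgD.
move=> t tT; have tT' := itvT_le tT.
have fpi : intg (fun x => f x * prim g x).
  by apply: (intg_ext _ (intg_ctsM (prim_cts gi) fi)) => x _; rewrite mulrC.
have pgi : intg (fun x => prim f x * g x) by apply: intg_ctsM => //; exact: prim_cts.
(* Writing F and G as initial value plus primitive leaves the rule for primitives and two terms
   linear in f and g. *)
rewrite (@eq_prim _ _ (fun x => f x * prim g x + prim f x * g x +
  (G 0 * f x + F 0 * g x)))//; last by move=> x xT; rewrite Ff// Gg//; ring.
rewrite primD//; [|exact: intgD|by apply: intgD; exact: intgZ].
rewrite prod_rule_intg// (primD tT' (intgZ _ fi) (intgZ _ gi)) !primZ//.
by rewrite (Ff t tT) (Gg t tT); ring.
Qed.

Lemma cauchy_schwarz f g : L2 f -> L2 g ->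
  prim (fun x => f x * g x) T ^+ 2 <=
  prim (fun x => f x ^+ 2) T * prim (fun x => g x ^+ 2) T.
Proof.
move=> Lf Lg; have fi := L2_intg_sq Lf; have gi := L2_intg_sq Lg.
have fgi := L2_intgM Lf Lg; apply: quad_form_discr => s t.
rewrite -!primZ// -primB//; [|exact: intgZ..].
rewrite -primD//; [|by apply: intgB; exact: intgZ|exact: intgZ].
apply: prim_ge0 => // x _.
rewrite [leRHS](_ : _ = (s * f x - t * g x) ^+ 2) ?sqr_ge0//; ring.
Qed.
End product_rule.

(** * Almost everywhere uniqueness of densities *)

Section density_uniqueness.
Context {R : realType}.
Notation T := (2 * pi).
Notation mu := (@lebesgue_measure R).
Implicit Types (f g F G a b : R -> R) (t : R).

Let ae_filter : Filter (almost_everywhere mu) := ae_filter_ringOfSetsType mu.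

Lemma ae_neq (c : R) : {ae mu, forall x, x != c}.
Proof.
exists [set c]; split => //; first exact: lebesgue_measure_set1.
by move=> x /= /negP; rewrite negbK => /eqP.
Qed.

Definition aeq f g := {ae mu, forall x, `[0, T]%classic x -> f x = g x}.

Lemma aeq_prim_t f g t : `[0, T]%classic t -> intg f -> intg g -> aeq f g ->
  prim f t = prim g t.
Proof.
move=> /itvT_le tT fi gi fg; rewrite /prim /Rintegral; congr fine.
apply: ae_eq_integral => //.
- by have /integrableP[] := intg_sub tT fi.
- by have /integrableP[] := intg_sub tT gi.
- by apply: (@filterS _ _ ae_filter _ _ _ fg) => x H /(sub0t tT) xT; rewrite H.
Qed.

Lemma aeq_prim f g : intg f -> intg g -> aeq f g -> prim f T = prim g T.
Proof. by apply: aeq_prim_t; exact: itv0T_T. Qed.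

Lemma ac_aeq F f g : intg g -> aeq f g -> ac F f -> ac F g.
Proof.
by move=> gi fg [fi Ff]; split=> // t tT; rewrite Ff// (aeq_prim_t tT fi gi fg).
Qed.

(** Lebesgue differentiation is applied to the extension of [f] by zero to the line: at almost every
    interior point [f] is the derivative of a primitive that vanishes nearby. The two endpoints are
    discarded as a null set. *)
Lemma ac0_aeq f : ac (fun=> 0) f -> aeq f (fun=> 0).
Proof.
move=> [fi f0]; pose g := f \_ `[0, T].
have gi : mu.-integrable setT (EFin \o g).
  by rewrite -restrict_EFin; apply/integrable_restrict; rewrite ?setTI.
have lg : locally_integrable setT g by apply: integrable_locally.
have := @FTC1 _ g (BLeft 0) _ lg.
have gy y : mu.-integrable `[0, y] (EFin \o g).
  exact: integrableS gi.
move=> /(_ gy).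
apply: (@filterS3 _ _ ae_filter _ _ _ _ _ (ae_neq 0) (ae_neq T)) => x x0 xT H /=.
rewrite in_itv/= => /andP[x0' xT'].
have {}x0 : 0 < x by rewrite lt_def x0.
have {}xT : x < T by rewrite lt_def eq_sym xT.
have [|dp pE] := H; first by rewrite /= lte_fin.
move: pE; rewrite /g patchE mem_set; last by rewrite /= in_itv/= x0' xT'.
move=> <-; rewrite derive1E.
rewrite (@near_eq_derive _ _ _ _ (fun=> 0))// ?derive_cst//.
have : x \in `]0, T[ by rewrite in_itv/= x0.
move/near_in_itvoo; apply: filterS => y; rewrite in_itv/= => /andP[y0 yT].
have := f0 y; rewrite /= in_itv/= (ltW y0) ltW// => /(_ isT).
rewrite add0r => p0; rewrite [RHS]p0; apply: eq_Rintegral => z.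
rewrite inE/= in_itv/= => /andP[z0 zy].
by rewrite patchE mem_set//= in_itv/= z0 (le_trans zy)// ltW.
Qed.

Lemma ac_aeq_unique F f g : ac F f -> ac F g -> aeq f g.
Proof.
move=> Ff Fg; have : ac (fun=> 0) (fun x => f x - g x).
  by apply: ac_ext (acB Ff Fg) => // x _; rewrite subrr.
move=> /ac0_aeq; apply: (@filterS _ _ ae_filter) => x H xT; apply/eqP.
by rewrite -subr_eq0 H.
Qed.

Lemma cts_eq_interior f g : cts f -> cts g ->
  (forall x, 0 < x < T -> f x = g x) -> forall x, `[0, T]%classic x -> f x = g x.
Proof.
move=> cf cg fg; have di x : 0 < x < T -> f x - g x = 0.
  by move=> /fg ->; rewrite subrr.
have /(continuous_within_itvP _ T_gt0)[_ c0 cT] := ctsB cf cg.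
move=> x xT; apply/eqP; rewrite -subr_eq0; apply/eqP.
move: xT; rewrite /= in_itv/= => /andP[].
rewrite le_eqVlt => /predU1P[<- _|x0].
  apply: (cvg_unique _ c0) => //; apply: cvg_near_cst.
  near=> y; apply: di; apply/andP; split => //.
  by near: y; apply: nbhs_right_lt; exact: T_gt0.
rewrite le_eqVlt => /predU1P[->|xT]; last by apply: di; rewrite x0.
apply: (cvg_unique _ cT) => //; apply: cvg_near_cst.
near=> y; apply: di; apply/andP; split => //.
by near: y; apply: nbhs_left_gt; exact: T_gt0.
Unshelve. all: by end_near. Qed.

(** Inside the interval both densities are the classical derivative of [F]; continuity carries the
    equality to the endpoints. *)
Lemma ac_cts_unique F f g : ac F f -> ac F g -> cts f -> cts g ->
  forall x, `[0, T]%classic x -> f x = g x.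
Proof.
move=> Ff Fg cf cg; apply: cts_eq_interior => // x xT.
have df := ac_is_derive Ff cf xT; have dg := ac_is_derive Fg cg xT.
by rewrite -(@derive_val _ _ _ _ _ _ _ df) (@derive_val _ _ _ _ _ _ _ dg).
Qed.
End density_uniqueness.

(** * Weak derivatives on the circle *)

Section trigonometric_polynomials.
Context {R : realType}.
Notation T := (2 * pi).
Implicit Types (f g : R -> R) (a b c k x : R).

Lemma is_derive_affine k a x : is_derive x 1 (fun y => k * (y - a)) k.
Proof.
have H : is_derive x 1 (fun y : R => k *: (y - a)) (k *: (1 - 0)).
  by apply: is_deriveZ; apply: is_deriveB.
by apply: (is_derive_eq H); rewrite subr0 /GRing.scale/= mulr1.
Qed.

Lemma is_derive_cosk k a x :
  is_derive x 1 (fun y => cos (k * (y - a))) (- (k * sin (k * (x - a)))).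
Proof.
have H := is_derive1_comp (is_derive_cos _) (is_derive_affine k a x).
by apply: (is_derive_eq H); ring.
Qed.

Lemma is_derive_sink k a x :
  is_derive x 1 (fun y => sin (k * (y - a))) (k * cos (k * (x - a))).
Proof.
have H := is_derive1_comp (is_derive_sin _) (is_derive_affine k a x).
by apply: (is_derive_eq H); ring.
Qed.

(** Each term carries its own phase [a]: the class then contains peaks centred at any point, and
    differentiation keeps the phases. *)
Inductive trig_poly : (R -> R) -> Prop :=
| trig_poly0 : trig_poly (fun=> 0)
| trig_polyS f (n : nat) a b c : trig_poly f ->
    trig_poly (fun x => f x + (b * cos (n%:R * (x - a)) + c * sin (n%:R * (x - a)))).

Lemma is_derive_trigD f df (n : nat) a b c x : is_derive x 1 f df ->
  is_derive x 1
    (fun x => f x + (b * cos (n%:R * (x - a)) + c * sin (n%:R * (x - a))))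
    (df + (c * n%:R * cos (n%:R * (x - a)) + - (b * n%:R) * sin (n%:R * (x - a)))).
Proof.
move=> dfx.
have H : is_derive x 1 (f + (b *: (fun x => cos (n%:R * (x - a))) +
    c *: (fun x => sin (n%:R * (x - a)))))
    (df + (b *: (- (n%:R * sin (n%:R * (x - a)))) +
      c *: (n%:R * cos (n%:R * (x - a))))).
  exact: (is_deriveD dfx (is_deriveD (is_deriveZ _ (is_derive_cosk _ _ _))
    (is_deriveZ _ (is_derive_sink _ _ _)))).
by apply: (is_derive_eq H); rewrite /GRing.scale/=; ring.
Qed.

Lemma trig_poly_derive f : trig_poly f ->
  exists2 g, trig_poly g & forall x, is_derive x 1 f (g x).
Proof.
elim => [|{}f n a b c _ [g tg dg]].
  by exists (fun=> 0) => [|x]; [exact: trig_poly0|exact: is_derive_cst].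
exists (fun x => g x + (c * n%:R * cos (n%:R * (x - a)) +
  - (b * n%:R) * sin (n%:R * (x - a)))); first exact: trig_polyS.
by move=> x; exact: is_derive_trigD.
Qed.

(** Constant terms (n = 0) have no periodic antiderivative; they are collected in [c]. *)
Lemma trig_poly_antiderivative f : trig_poly f ->
  exists (g : R -> R) c, trig_poly g /\ forall x, is_derive x 1 g (f x - c).
Proof.
elim => [|{}f n a b c _ [g [m [tg dg]]]].
  by exists (fun=> 0), 0; split=> [|x]; [exact: trig_poly0|rewrite subr0; exact: is_derive_cst].
have [->|n0] := eqVneq n 0.
  exists g, (m + b); split=> // x.
  by rewrite !mul0r cos0 sin0 (_ : _ - _ = f x - m)//; ring.
exists (fun x => g x + (- (c / n%:R) * cos (n%:R * (x - a)) +
  b / n%:R * sin (n%:R * (x - a)))), m; split; first exact: trig_polyS.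
move=> x; apply: (is_derive_eq (is_derive_trigD n a _ _ (dg x))).
by field; rewrite pnatr_eq0.
Qed.

Lemma trig_poly_periodic f : trig_poly f -> periodic f T.
Proof.
elim => [//|{}f n a b c _ pf] x; rewrite pf.
have -> : n%:R * (x + T - a) = n%:R * (x - a) + pi *+ 2 *+ n.
  by rewrite -[pi *+ 2]mulr_natl -mulr_natl; ring.
by rewrite (periodicn (@cosD2pi R)) (periodicn (@sinD2pi R)).
Qed.

Lemma trig_poly_derive1 f : trig_poly f -> trig_poly (derive1 f).
Proof.
move=> /trig_poly_derive[g tg dg]; rewrite (_ : derive1 f = g)//.
by apply/funext => x; rewrite derive1E derive_val.
Qed.

Lemma trig_poly_is_derive f x : trig_poly f -> is_derive x 1 f (derive1 f x).
Proof.
move=> /trig_poly_derive[g tg dg]; rewrite (_ : derive1 f = g)//.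
by apply/funext => y; rewrite derive1E derive_val.
Qed.

Lemma trig_poly_test f : trig_poly f -> circle_test f.
Proof.
move=> tf; split; first exact: trig_poly_periodic.
move=> n x; have tn : trig_poly (derive1n n f).
  by elim: n => [//|n ih]; rewrite derive1nS; exact: trig_poly_derive1.
by have [] := trig_poly_is_derive x tn.
Qed.

Lemma trig_poly_continuous f : trig_poly f -> continuous f.
Proof.
move=> tf x; apply/differentiable_continuous/derivable1_diffP.
by have [] := trig_poly_is_derive x tf.
Qed.

Lemma trig_poly_cst c : trig_poly (fun=> c).
Proof.
have := @trig_polyS _ 0 0 c 0 trig_poly0; congr trig_poly; apply/funext => x.
by rewrite mul0r cos0 sin0; ring.
Qed.

(** Trigonometric polynomials even about [a]; their stability under multiplication by b + cos (x -
    a) puts the powers of that kernel among the test functions. *)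
Inductive cos_poly a : (R -> R) -> Prop :=
| cos_poly0 : cos_poly a (fun=> 0)
| cos_polyS f (n : nat) c : cos_poly a f ->
    cos_poly a (fun x => f x + c * cos (n%:R * (x - a))).

Lemma cos_poly_trig a f : cos_poly a f -> trig_poly f.
Proof.
elim => [|{}f n c _ tf]; first exact: trig_poly0.
have := @trig_polyS _ n a c 0 tf; congr trig_poly; apply/funext => x.
by rewrite mul0r addr0.
Qed.

(** Product to sum: 2 cos (n y) cos y = cos ((n + 1) y) + cos ((n - 1) y), with n = 0 apart since
    frequencies are natural numbers. *)
Lemma cos_polyM a b f : cos_poly a f ->
  cos_poly a (fun x => f x * (b + cos (x - a))).
Proof.
elim => [|{}f n c _ pf].
  have := cos_poly0 a; congr cos_poly; apply/funext => x; by rewrite mul0r.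
case: n => [|n].
  have := @cos_polyS _ _ 0 (c * b) (@cos_polyS _ _ 1 c pf).
  congr cos_poly; apply/funext => x; rewrite !mul0r cos0 mul1r; ring.
have := @cos_polyS _ _ n.+1 (c * b)
  (@cos_polyS _ _ n.+2 (c / 2) (@cos_polyS _ _ n (c / 2) pf)).
congr cos_poly; apply/funext => x; move: (f x) (x - a) => fx y.
have -> : n.+2%:R * y = n.+1%:R * y + y by rewrite -[n.+2]addn1 natrD; ring.
have -> : n%:R * y = n.+1%:R * y - y by rewrite -[n.+1]addn1 natrD; ring.
by rewrite cosB cosD; field.
Qed.

Lemma cos_poly_exp a b n : cos_poly a (fun x => (b + cos (x - a)) ^+ n).
Proof.
elim: n => [|n ih].
  have := @cos_polyS _ _ 0 1 (cos_poly0 a); congr cos_poly; apply/funext => x.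
  by rewrite mul0r cos0 expr0; ring.
by have := cos_polyM b ih; congr cos_poly; apply/funext => x; rewrite exprSr.
Qed.
End trigonometric_polynomials.

(** * Localization by peaking kernels *)

Section du_bois_reymond.
Context {R : realType}.
Notation T := (2 * pi).
Notation mu := (@lebesgue_measure R).
Implicit Types (f g : R -> R) (a b c k x : R).

Lemma prim_indic (p q : R) : 0 <= p -> p <= q -> q <= T ->
  intg (\1_(`[p, q]%classic)) /\ prim (\1_(`[p, q]%classic)) T = q - p.
Proof.
move=> p0 pq qT; have mpq : measurable (`[p, q]%classic : set (measurableTypeR R)).
  exact: measurable_itv.
have sub : `[p, q] `<=` `[0, T].
  by move=> x; rewrite /= !in_itv/= => /andP[/(le_trans p0) -> /le_trans->].
split; first exact: (integrableS _ _ (subsetT _) (integrable_indic_itv p q true false)).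
rewrite /prim /Rintegral integral_indic//.
rewrite (setIidl sub) /=.
have -> : lebesgue_measure `[p, q]%classic = (q - p)%:E.
  rewrite lebesgue_measure_itv/= lte_fin; case: ltP => [_//|qp].
  by rewrite (_ : q - p = 0)//; apply/eqP; rewrite subr_eq0 eq_le pq qp.
by [].
Qed.

Lemma cos_le_off_peak (d y : R) : 0 <= d -> d <= `|y| -> `|y| <= T - d ->
  cos y <= cos d.
Proof.
move=> d0 dy yT; rewrite -cos_norm; move: (`|y|) dy yT => {}y dy yT.
have [ypi|piy] := leP y pi.
  have [->//|] := eqVneq d y => dny.
  by rewrite ltW// ltr_cos// ?in_itv/= ?d0 ?ypi ?(le_trans dy) ?(le_trans d0)// lt_neqAle dny.
have -> : cos y = cos (T - y).
  rewrite cosB (_ : T = pi *+ 2); last by rewrite mulr_natl.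
  by rewrite cos2pi sin2pi mul1r mul0r addr0.
have [->//|] := eqVneq d (T - y) => dny.
rewrite ltW// ltr_cos// ?in_itv/= ?lt_neqAle ?dny/=; lra.
Qed.

(* If f a > 0, the powers of 1 - cos d + cos (x - a), which is > 1 only near a,
   make the integral tend to infinity. *)
Lemma peak_nonpos f a : cts f -> 0 < a < T ->
  (forall b n, prim (fun x => f x * (b + cos (x - a)) ^+ n) T = 0) -> f a <= 0.
Proof.
move=> cf aT H; rewrite leNgt; apply/negP => fa0; case/andP: (aT) => a0 aT'.
have [M M0 fM] := cts_bounded cf.
have := cts_interior cf aT; move=> /cvgrPdist_lt /(_ (f a / 2)).
rewrite divr_gt0// => /(_ isT) /nbhs_ballP[r /= r0 Hr].
(* On |x - a| <= d the function stays above f a / 2, and this window lies inside [0, T]. *)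
pose d := Num.min (r / 2) (Num.min (a / 2) ((T - a) / 2)).
have d0 : 0 < d by rewrite !lt_min !divr_gt0//= subr_gt0.
have dr : d < r by apply: (@le_lt_trans _ _ (r / 2)); [rewrite !ge_min lexx|lra].
have da : d <= a / 2 by rewrite !ge_min lexx orbT.
have dT : d <= (T - a) / 2 by rewrite !ge_min lexx !orbT.
have near_a x : `|x - a| <= d -> f a / 2 <= f x.
  move=> xa; have : ball a r x by rewrite /ball/= distrC (le_lt_trans xa).
  by move=> /Hr/=; rewrite ltr_norml => /andP[]; lra.
(* The kernel 1 - cos d + cos (x - a) is at least 1 + eta on |x - a| <= d / 2, at least 1 on |x - a|
   <= d, and between -1 and 1 on the rest of the period. *)
pose eta := cos (d / 2) - cos d.
have dpi : d < pi by have := pi_gt0 R; lra.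
have eta0 : 0 < eta.
  by rewrite subr_gt0 ltr_cos ?in_itv/=; lra.
have bound n x : `[0, T]%classic x ->
    f a / 2 * (1 + eta) ^+ n * \1_(`[a - d / 2, a + d / 2]%classic) x - M <=
    f x * ((1 - cos d) + cos (x - a)) ^+ n.
  move=> xT; have xM := fM _ xT; move: xT; rewrite /= in_itv/= => /andP[x0 xT].
  have [xd|dx] := leP (`|x - a|) d.
    have fx := near_a x xd.
    have cx : cos d <= cos (x - a).
      rewrite -(cos_norm (x - a)).
      have [->//|xnd] := eqVneq (`|x - a|) d.
      rewrite ltW// ltr_cos ?in_itv/= ?normr_ge0//; last 2 first.
        by rewrite (le_trans xd)// ltW.
        by rewrite !ltW.
      by rewrite lt_neqAle xnd.
    have pe : 0 <= f x * ((1 - cos d) + cos (x - a)) ^+ n.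
      by apply: mulr_ge0; [lra|apply: exprn_ge0; lra].
    rewrite indicE; have [|_] := boolP (x \in _); last first.
      by rewrite mulr0 sub0r; lra.
    rewrite inE/= in_itv/= mulr1 => /andP[x1 x2].
    rewrite -[leRHS]subr0; apply: lerB; last exact: ltW.
    apply: ler_pM; [lra|apply: exprn_ge0; lra|done|].
    apply: lerXn2r; rewrite ?nnegrE; [lra| |].
      lra.
    suff : cos (d / 2) <= cos (x - a) by rewrite /eta; lra.
    rewrite -(cos_norm (x - a)).
    have xd2 : `|x - a| <= d / 2 by rewrite ler_norml; lra.
    have [->//|xnd] := eqVneq (`|x - a|) (d / 2).
    rewrite ltW// ltr_cos ?in_itv/= ?normr_ge0//; [|lra..].
    by rewrite lt_neqAle xnd.
  rewrite indicE memNset/=; last first.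
    rewrite in_itv/= => /andP[x1 x2].
    have : `|x - a| <= d / 2 by rewrite ler_norml; lra.
    lra.
  rewrite mulr0 sub0r.
  have cx : cos (x - a) <= cos d.
    apply: cos_le_off_peak; [exact: ltW..|].
    by rewrite ler_norml; lra.
  have c1 := cos_le1 d; have c2 := cos_geN1 (x - a); have c3 := cos_geN1 d.
  have c4 : cos d <= 1 := c1.
  have be : `|1 - cos d + cos (x - a)| <= 1 by rewrite ler_norml; lra.
  have : `|f x * (1 - cos d + cos (x - a)) ^+ n| <= M.
    rewrite normrM normrX -[leRHS]mulr1; apply: ler_pM => //.
    exact: exprn_ile1.
  by rewrite ler_norml => /andP[].
have [|||ii pi_] := @prim_indic (a - d / 2) (a + d / 2); [lra..|].
have ineq n : f a / 2 * (1 + eta) ^+ n * d <= M * T.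
  rewrite -subr_le0 -(H (1 - cos d) n).
  have -> : f a / 2 * (1 + eta) ^+ n * d - M * T = prim (fun x =>
    f a / 2 * (1 + eta) ^+ n * \1_(`[a - d / 2, a + d / 2]%classic) x - M) T.
    rewrite primB//; [|exact: intgZ|exact/cts_intg/cts_cst].
    rewrite primZ// pi_ prim_cst//; last exact/ltW/T_gt0.
    by congr (_ * _ - _); field.
  apply: le_prim => // [||x]; last exact: bound.
    by apply: intgB; [exact: intgZ|exact/cts_intg/cts_cst].
  apply: cts_intg; apply: ctsM => //; apply: continuous_cts.
  exact/trig_poly_continuous/(cos_poly_trig (cos_poly_exp a _ n)).
(* Bernoulli's inequality (1 + eta)^n >= 1 + n eta contradicts [ineq] as soon as n > C. *)
pose C := M * T / (f a / 2 * d * eta).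
have fde : 0 < f a / 2 * d * eta by rewrite !mulr_gt0.
have C0 : 0 <= C by rewrite divr_ge0// ?ltW// mulr_gt0// T_gt0.
have := ineq (Num.Def.truncn C).+1; apply/negP; rewrite -ltNge.
set n := (Num.Def.truncn C).+1.
have Cn : C < n%:R by apply: truncnS_gt.
have Bern : 1 + n%:R * eta <= (1 + eta) ^+ n.
  elim: n {Cn} => [|n ih]; first by rewrite mul0r addr0 expr0.
  rewrite exprS -natr1; apply: (le_trans _ (ler_wpM2l _ ih)); last by lra.
  have := mulr_ge0 (ler0n R n) (sqr_ge0 eta); rewrite expr2; lra.
have : C * (f a / 2 * d * eta) < n%:R * (f a / 2 * d * eta) by rewrite ltr_pM2r.
rewrite divfK ?gt_eqF// => /lt_le_trans; apply.
have -> : n%:R * (f a / 2 * d * eta) = f a / 2 * d * (n%:R * eta) by ring.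
rewrite (mulrAC (f a / 2) _ d) ler_wpM2l//; last by apply: le_trans Bern; rewrite lerDr.
by rewrite ltW// mulr_gt0// divr_gt0.
Qed.
End du_bois_reymond.

(** * The du Bois-Reymond lemma and absolutely continuous representatives *)

Section du_bois_reymond.
Context {R : realType}.
Notation T := (2 * pi).
Notation mu := (@lebesgue_measure R).
Implicit Types (f g : R -> R) (a b c k x : R).


Lemma prim_derive_trig_poly f : trig_poly f -> prim (derive1 f) T = 0.
Proof.
move=> tf; have /ac_prim_T -> : ac f (derive1 f).
  apply: ac_smooth; first by move=> x; exact: trig_poly_is_derive.
  exact/trig_poly_continuous/trig_poly_derive1.
by rewrite -{1}(add0r T) trig_poly_periodic// subrr.
Qed.

Lemma trig_poly_cts f : trig_poly f -> cts f.
Proof. by move=> tf; exact/continuous_cts/trig_poly_continuous. Qed.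

Lemma ac_trig_poly f : trig_poly f -> ac f (derive1 f).
Proof.
move=> tf; apply: ac_smooth; first by move=> x; exact: trig_poly_is_derive.
exact/trig_poly_continuous/trig_poly_derive1.
Qed.

Lemma intg_Mcts f g : intg f -> cts g -> intg (fun x => f x * g x).
Proof.
by move=> fi cg; apply: (intg_ext _ (intg_ctsM cg fi)) => x _; rewrite mulrC.
Qed.

(** Each test function is the derivative of a test function plus a constant, and f minus its mean is
    orthogonal to both. *)
Lemma prim_trig_poly_mean_free f : intg f ->
  (forall phi, trig_poly phi -> prim (fun x => f x * derive1 phi x) T = 0) ->
  forall phi, trig_poly phi -> prim (fun x => (f x - prim f T / T) * phi x) T = 0.
Proof.
move=> fi H phi tphi; have [g [c [tg dg]]] := trig_poly_antiderivative tphi.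
set m := prim f T / T.
have gE x : derive1 g x = phi x - c by rewrite derive1E derive_val.
have cg : cts (derive1 g) by exact/trig_poly_cts/trig_poly_derive1.
have -> : prim (fun x => (f x - m) * phi x) T =
    prim (fun x => (f x * derive1 g x - m * derive1 g x) + c * (f x - m)) T.
  by apply: eq_prim => // x _; rewrite gE; ring.
have i1 : intg (fun x => f x * derive1 g x) by exact: intg_Mcts.
have i2 : intg (fun x => m * derive1 g x) by exact/intgZ/cts_intg.
have im : intg (fun=> m) := cts_intg (@cts_cst _ m).
rewrite primD//; [|exact: intgB|by apply: intgZ; exact: intgB].
rewrite primB// H// !primZ//; [|exact: intgB|exact: cts_intg].
rewrite prim_derive_trig_poly// primB// prim_cst//; last exact/ltW/T_gt0.
rewrite /m divfK; first by rewrite !subrr !mulr0 subrr addr0.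
by rewrite gt_eqF// T_gt0.
Qed.

(** Peaking kernels at each interior point, applied to f - m and to m - f with m the mean, give both
    inequalities. *)
Lemma cts_mean_free f : cts f ->
  (forall phi, trig_poly phi -> prim (fun x => f x * derive1 phi x) T = 0) ->
  forall x, `[0, T]%classic x -> f x = prim f T / T.
Proof.
move=> cf H; have H' := prim_trig_poly_mean_free (cts_intg cf) H.
set m := prim f T / T in H' *.
have cfm : cts (fun x => f x - m) by apply: ctsB => //; exact: cts_cst.
apply: cts_eq_interior => //; first exact: cts_cst.
move=> x xT; apply/eqP; rewrite eq_le; apply/andP; split.
  rewrite -subr_le0; apply: (peak_nonpos cfm xT) => b n.
  exact/H'/(cos_poly_trig (cos_poly_exp x b n)).
rewrite -subr_ge0 -oppr_le0; apply: (peak_nonpos (ctsN cfm) xT) => b n.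
have tp := cos_poly_trig (cos_poly_exp x b n).
rewrite (@eq_prim _ _ (fun y => -1 * ((f y - m) * (b + cos (y - x)) ^+ n)))//.
  rewrite primZ ?(H' _ tp) ?mulr0//.
  by apply: cts_intg; apply: ctsM => //; exact: trig_poly_cts.
by move=> y _; ring.
Qed.

(** The weak derivative is tested on trigonometric polynomials alone, which suffices for the
    regularity below. *)
Definition weak1 f g := forall phi, trig_poly phi ->
  prim (fun x => f x * derive1 phi x) T = - prim (fun x => g x * phi x) T.

Lemma weak1_ac f g : intg f -> intg g -> weak1 f g ->
  exists F, [/\ ac F g, F T = F 0 & aeq f F].
Proof.
move=> fi gi fg.
(* The test function 1 shows that [g] has mean zero, so its primitive takes equal values at 0 and
   T. *)
have g0 : prim g T = 0.
  have /fg := @trig_poly_cst R 1.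
  rewrite (@eq_prim _ _ (fun=> 0)); [|by []|]; last first.
    by move=> x _; rewrite derive1_cst mulr0.
  rewrite prim_cst ?mul0r; last exact/ltW/T_gt0.
  move/eqP; rewrite eq_sym oppr_eq0 => /eqP; rewrite -[X in _ -> _ = X]/0 => <-.
  by apply: eq_prim => // x _; rewrite mulr1.
have acV := ac_prim gi; have cV := ac_cts acV.
pose D x := f x - prim g x; have Di : intg D by apply: intgB => //; exact: cts_intg.
have orth phi : trig_poly phi -> prim (fun x => D x * derive1 phi x) T = 0.
  move=> tp; have cp := trig_poly_cts tp.
  have cp' := trig_poly_cts (trig_poly_derive1 tp).
  have := ac_prim_T (acM acV (ac_trig_poly tp)).
  have i1 : intg (fun x => g x * phi x) by exact: intg_Mcts.
  have i2 : intg (fun x => prim g x * derive1 phi x) by apply: cts_intg; exact: ctsM.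
  have i3 : intg (fun x => f x * derive1 phi x) by exact: intg_Mcts.
  rewrite primD// g0 prim0 !mul0r subrr => E.
  rewrite (@eq_prim _ _ (fun x => f x * derive1 phi x - prim g x * derive1 phi x))//.
    by rewrite primB// fg// -opprD E oppr0.
  by move=> x _; rewrite /D mulrBl.
set m := prim D T / T.
have mi : intg (fun=> m) := cts_intg (@cts_cst _ m).
have Dmi : intg (fun x => D x - m) by exact: intgB.
(* [D - m] is only integrable, so the continuous lemma is applied to its primitive: integration by
   parts makes the primitive orthogonal to derivatives, hence constant, hence zero, and [D] equals
   [m] almost everywhere. *)
have acP := ac_prim Dmi.
have DmT : prim (fun x => D x - m) T = 0.
  rewrite primB// prim_cst; last exact/ltW/T_gt0.
  by rewrite /m divfK ?subrr// gt_eqF// T_gt0.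
have P0 x : `[0, T]%classic x -> prim (fun x => D x - m) x = 0.
  have cm := @cts_mean_free (prim (fun x => D x - m)) (ac_cts acP) _.
  have h : forall phi, trig_poly phi ->
      prim (fun x => prim (fun x => D x - m) x * derive1 phi x) T = 0.
    move=> phi tp; have cp := trig_poly_cts tp.
    have cp' := trig_poly_cts (trig_poly_derive1 tp).
    have := ac_prim_T (acM acP (ac_trig_poly tp)).
    have i1 : intg (fun x => (D x - m) * phi x) by exact: intg_Mcts.
    have i2 : intg (fun x => prim (fun x => D x - m) x * derive1 phi x).
      by apply/cts_intg/ctsM => //; exact: ac_cts acP.
    rewrite (primD _ i1 i2)//.
    rewrite (prim_trig_poly_mean_free Di orth tp) add0r => ->.
    by rewrite DmT prim0 !mul0r subrr.
  move=> xT; rewrite (cm h x xT) -(cm h 0 itv0T_0).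
  by rewrite prim0.
exists (fun x => prim g x + m); split.
- have := acD acV (ac_cst m); apply: ac_ext => // x _; by rewrite addr0.
- by rewrite g0 prim0.
have /ac0_aeq : ac (fun=> 0) (fun x => D x - m).
  by split => // t tT; rewrite P0// addr0.
apply: (@filterS _ _ (ae_filter_ringOfSetsType mu)) => x H xT.
have := H xT; rewrite /D => /eqP; rewrite subr_eq0 subr_eq => /eqP ->.
by rewrite addrC.
Qed.

Lemma aeq_cts_eq f g : cts f -> cts g -> aeq f g ->
  forall x, `[0, T]%classic x -> f x = g x.
Proof.
move=> cf cg fg; apply: (ac_cts_unique (F := prim f)) => //.
  exact/ac_prim/cts_intg.
by apply: (ac_aeq (cts_intg cg) fg); exact/ac_prim/cts_intg.
Qed.

(** Testing [u] against phi' and comparing the two weak derivatives shows that [u1] has weak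
    derivative [u2], so it has a continuous representative [W]. A second application, to [u] and
    [W], gives an identity that holds at every point because [u] is continuous. *)
Lemma sobolev_H2_ac (u u1 u2 : R -> R) : sobolev_H2 u u1 u2 ->
  exists W, [/\ ac u W, ac W u2, u T = u 0, W T = W 0 & aeq u1 W].
Proof.
case=> -[cu Lu [_ mu1 iu1] [_ mu2 iu2] [w1 w2]].
have L1 : L2 u1 by []. have L2' : L2 u2 by [].
have ctu : cts u by exact: continuous_cts.
have h1 : weak1 u u1.
  by move=> phi /trig_poly_test /w1; rewrite expr1 mulN1r.
have h2 : weak1 u1 u2.
  move=> phi tp.
  have E : prim (fun x => u x * derive1 (derive1 phi) x) T = prim (fun x => u2 x * phi x) T.
    by have := w2 _ (trig_poly_test tp); rewrite sqrrN expr1n mul1r.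
  apply: oppr_inj; rewrite opprK.
  exact: etrans (esym (h1 _ (trig_poly_derive1 tp))) E.
have [W [acW WT u1W]] := weak1_ac (L2_intg L1) (L2_intg L2') h2.
have cW := ac_cts acW.
have h3 : weak1 u W.
  move=> phi tp; have cp := trig_poly_cts tp; rewrite h1//; congr (- _).
  apply: aeq_prim; [by apply: intg_Mcts => //; exact: L2_intg|exact/cts_intg/ctsM|].
  apply: (@filterS _ _ (ae_filter_ringOfSetsType mu) _ _ _ u1W) => x H xT.
  by rewrite H.
have [U [acU UT uU]] := weak1_ac (cts_intg ctu) (cts_intg cW) h3.
have uUE := aeq_cts_eq ctu (ac_cts acU) uU.
exists W; split => //.
  by apply: ac_ext acU => // x xT; rewrite uUE.
by rewrite uUE ?uUE ?UT//; [exact: itv0T_0|exact: itv0T_T].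
Qed.
End du_bois_reymond.

(** * Hill's equation with antiperiodic solutions *)

Section pi_bound.
Context {R : realType}.
Notation T := (2 * pi).
Implicit Types (f g F G : R -> R).

Lemma ac_le F G f g : ac F f -> ac G g -> F 0 <= G 0 ->
  (forall x, `[0, T]%classic x -> f x <= g x) ->
  forall x, `[0, T]%classic x -> F x <= G x.
Proof.
move=> [fi Ff] [gi Gg] FG0 fg x xT; rewrite Ff// Gg//; apply: lerD => //.
by apply: le_prim => //; exact: itvT_le.
Qed.

Lemma ac_id : ac (fun x : R => x) (fun=> 1).
Proof. by apply: ac_smooth => x; exact: cvg_cst. Qed.

Lemma ac_sin : ac (@sin R) cos.
Proof. by apply: ac_smooth; exact: continuous_cos. Qed.

Lemma ac_Ncos : ac (fun x : R => - cos x) sin.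
Proof.
apply: ac_smooth; last exact: continuous_sin.
by move=> x; apply: (is_derive_eq (is_deriveN (is_derive_cos x))); rewrite opprK.
Qed.

Lemma ac_powX n : ac (fun x : R => x ^+ n.+1 / n.+1%:R) (fun x => x ^+ n).
Proof.
elim: n => [|n ih].
  by apply: ac_ext ac_id => x _; rewrite ?expr1 ?expr0 ?divr1.
have := acZ (n.+1%:R / n.+2%:R) (acM ih ac_id).
have := pnatr_eq0 R n.+1; have := pnatr_eq0 R n.+2.
have : n.+2%:R = n.+1%:R + 1 :> R by rewrite natr1.
move: (n.+1%:R : R) (n.+2%:R : R) => a c -> /negbT c0 /negbT a0.
by apply: ac_ext => x _; rewrite !exprS; field; rewrite ?a0 ?c0.
Qed.

(** Integrating cos <= 1 three times from 0 bounds sin from above, then - cos from above, then sin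
    from below. *)
Lemma sin_ge_cubic (x : R) : `[0, T]%classic x -> x - x ^+ 3 / 6 <= sin x.
Proof.
move=> xT.
have h1 (y : R) : `[0, T]%classic y -> sin y <= y.
  move=> yT; apply: (ac_le ac_sin ac_id _ _ yT); first by rewrite sin0.
  by move=> z _; exact: cos_le1.
have h2 (y : R) : `[0, T]%classic y -> - cos y <= y ^+ 2 / 2 - 1.
  move=> yT; apply: (ac_le ac_Ncos (acB (ac_powX 1) (ac_cst 1)) _ _ yT).
    by rewrite cos0 expr0n/= mul0r sub0r.
  by move=> z /h1; rewrite expr1 subr0.
have -> : x - x ^+ 3 / 6 = x - 2^-1 * (x ^+ 3 / 3) by field.
apply: (ac_le (acB ac_id (acZ 2^-1 (ac_powX 2))) ac_sin _ _ xT).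
  by rewrite sin0 expr0n/= mul0r mulr0 subr0.
by move=> y /h2; lra.
Qed.

(** If pi^2 >= 10, then r = (pi / 4)^2 lies in [5 / 8, 1) and the cubic bound makes sin^2 (pi / 4)
    at least r (1 - r / 6)^2, which exceeds its true value 1 / 2. *)
Lemma pi_sqr_lt10 : pi ^+ 2 < 10 :> R.
Proof.
have pi0 := pi_gt0 R; have pi4 : pi < 4 :> R by have := @pihalf_lt2 R; lra.
have /sin_ge_cubic : `[0, T]%classic (pi / 4 : R) by rewrite /= in_itv/=; lra.
have s2 : sin (pi / 4 : R) ^+ 2 = 1 / 2.
  have := @cos_pihalf R; have -> : (pi / 2 : R) = (pi / 4) *+ 2 by field.
  by rewrite cos_mulr2n mulr2n sin2cos2; lra.
rewrite ltNge => h; apply/negP => q10.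
set q := pi / 4 in h s2 *; have q0 : 0 < q by rewrite divr_gt0.
have q1 : q < 1 by rewrite /q; lra.
have q2 : 5 / 8 <= q ^+ 2 by rewrite /q exprMn; lra.
have q3 : 0 <= q - q ^+ 3 / 6 by rewrite exprS; nra.
have : (q - q ^+ 3 / 6) ^+ 2 <= sin q ^+ 2 by rewrite ler_sqr ?nnegrE// (le_trans q3).
rewrite s2; have -> : (q - q ^+ 3 / 6) ^+ 2 = q ^+ 2 * (1 - q ^+ 2 / 6) ^+ 2 by ring.
have : q ^+ 2 < 1 by rewrite expr_lt1// ltW.
move: (q ^+ 2) q2 => r r1 r2; rewrite expr2; nra.
Qed.
End pi_bound.

Ltac solve_cts :=
  match goal with
  | H : cts ?f |- cts ?f => exact H
  | H : cts ?f |- cts (fun x => ?f x) => exact H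
  | |- cts (fun=> ?c) => exact: cts_cst
  | |- cts (fun x => - @?f x) => refine (@ctsN _ f _); solve_cts
  | |- cts (fun x => @?f x + @?g x) => refine (@ctsD _ f g _ _); solve_cts
  | |- cts (fun x => @?f x * @?g x) => refine (@ctsM _ f g _ _); solve_cts
  | |- cts (fun x => @?f x ^+ ?n) => refine (@ctsX _ f n _); solve_cts
  end.

(** * Calculus in the variable s with ds = rho dx, on a circle of s-length pi *)

Section sturm_liouville.
Context {R : realType}.
Notation T := (2 * pi).
Implicit Types (f g : R -> R).

Lemma prim_mono f t : `[0, T]%classic t -> intg f ->
  (forall x, `[0, T]%classic x -> 0 <= f x) -> prim f t <= prim f T.
Proof.
move=> tT fi f0; apply: le_trans (ler_norm _) _.
apply: (le_trans (prim_norm_le tT fi)).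
by rewrite (eq_prim (g := f))// => x xT; rewrite ger0_norm// f0.
Qed.

Lemma is_derive_inv (y : R) : y != 0 -> is_derive y 1 (fun x => x^-1) (- y ^- 2).
Proof.
move=> y0; have H : is_derive y 1 (fun x : R => (id x)^-1) (- y ^- 2 *: 1).
  by apply: (@is_deriveV _ id) => //; exact: is_derive_id.
by apply: (is_derive_eq H); rewrite /GRing.scale/= mulr1.
Qed.

Lemma acV F f : ac F f -> cts f -> (forall x, `[0, T]%classic x -> F x != 0) ->
  ac (fun x => (F x)^-1) (fun x => - (F x) ^- 2 * f x).
Proof.
move=> Ff cf F0; apply: (ac_comp (h' := fun y => - y ^- 2) Ff cf).
  by move=> x xT; apply: is_derive_inv; exact: F0.
apply: ctsN; apply: ctsV; first by apply: ctsX; exact: ac_cts Ff.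
by move=> x xT; rewrite expf_neq0// F0.
Qed.

Variables (rho : R -> R).
Hypothesis rho_cts : cts rho.
Hypothesis rho_ge0 : forall x, `[0, T]%classic x -> 0 <= rho x.
Hypothesis rho_pi : prim rho T = pi.

Let P f t := prim (fun x => rho x * f x) t.
(** The inner product of L2 (ds). The substitution is never performed: s is represented by the
    primitive of [rho], and functions remain functions of x. *)
Definition ip f g := prim (fun x => rho x * (f x * g x)) T.

Let PD f g t : `[0, T]%classic t -> cts f -> cts g ->
  P (fun x => f x + g x) t = P f t + P g t.
Proof.
move=> /itvT_le tT cf cg; rewrite /P -primD//; [|by apply/cts_intg/ctsM..].
by apply: eq_prim => // x _; rewrite mulrDr.
Qed.

Let PZ (k : R) f t : `[0, T]%classic t -> cts f ->
  P (fun x => k * f x) t = k * P f t.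
Proof.
move=> /itvT_le tT cf; rewrite /P -primZ//; [|by apply/cts_intg/ctsM..].
by apply: eq_prim => // x _; rewrite mulrCA.
Qed.

Lemma ip_ext f g f' g' : (forall x, `[0, T]%classic x -> f x = f' x) ->
  (forall x, `[0, T]%classic x -> g x = g' x) -> ip f g = ip f' g'.
Proof. by move=> ff gg; apply: eq_prim => // x xT; rewrite ff// gg. Qed.

Lemma ipC f g : ip f g = ip g f.
Proof. by apply: eq_prim => // x _; rewrite (mulrC (f x)). Qed.

Lemma ipDl f g h : cts f -> cts g -> cts h ->
  ip (fun x => f x + g x) h = ip f h + ip g h.
Proof.
move=> cf cg ch; rewrite /ip -primD//; [|by apply: cts_intg; solve_cts..].
by apply: eq_prim => // x _; ring.
Qed.

Lemma ipZl (k : R) f g : cts f -> cts g -> ip (fun x => k * f x) g = k * ip f g.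
Proof.
move=> cf cg; rewrite /ip -primZ//; last by apply: cts_intg; solve_cts.
by apply: eq_prim => // x _; ring.
Qed.

Lemma ipNl f g : cts f -> cts g -> ip (fun x => - f x) g = - ip f g.
Proof.
move=> cf cg; rewrite -[RHS]mulN1r -ipZl//.
by apply: ip_ext => // x _; rewrite mulN1r.
Qed.

Lemma ipBl f g h : cts f -> cts g -> cts h ->
  ip (fun x => f x - g x) h = ip f h - ip g h.
Proof.
by move=> cf cg ch; rewrite -ipNl// -ipDl//; exact: ctsN.
Qed.

Lemma ip_ge0 f : 0 <= ip f f.
Proof. by apply: prim_ge0 => // x xT; rewrite mulr_ge0 ?rho_ge0// -expr2 sqr_ge0. Qed.

(* phi is the derivative of f in the variable with differential rho dx. *)
Definition flux f phi := ac f (fun x => rho x * phi x) /\ cts phi.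

Lemma flux_cts f phi : flux f phi -> cts f.
Proof. by move=> [/ac_cts]. Qed.

Lemma fluxD f g phi psi : flux f phi -> flux g psi ->
  flux (fun x => f x + g x) (fun x => phi x + psi x).
Proof.
move=> [af cp] [ag cq]; split; last exact: ctsD.
by apply: ac_ext (acD af ag) => // x _; rewrite mulrDr.
Qed.

Lemma fluxZ (k : R) f phi : flux f phi ->
  flux (fun x => k * f x) (fun x => k * phi x).
Proof.
move=> [af cp]; split; last by apply: ctsM => //; exact: cts_cst.
by apply: ac_ext (acZ k af) => // x _; rewrite mulrCA.
Qed.

Lemma fluxB f g phi psi : flux f phi -> flux g psi ->
  flux (fun x => f x - g x) (fun x => phi x - psi x).
Proof.
move=> ff fg; have [af cp] := fluxD ff (fluxZ (-1) fg); split.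
  by apply: ac_ext af => x _; rewrite !mulN1r.
by apply: ctsB; [exact: ff.2|exact: fg.2].
Qed.

Lemma ip_by_parts f g phi psi : flux f phi -> flux g psi ->
  ip phi g + ip f psi = f T * g T - f 0 * g 0.
Proof.
move=> ff fg; have cf := flux_cts ff; have cg := flux_cts fg.
case: ff => af cp; case: fg => ag cq.
rewrite -(ac_prim_T (acM af ag)) /ip -primD//; [|by apply: cts_intg; solve_cts..].
by apply: eq_prim => // x _; ring.
Qed.

Let sigma := prim rho.
(** Together with [mode2], these are cos s and sin s; as the total s-length is pi, they are the
    lowest antiperiodic modes. *)
Definition mode1 x := cos (sigma x).
Definition mode2 x := sin (sigma x).

Let ac_sigma : ac sigma rho. Proof. exact/ac_prim/cts_intg. Qed.
Let cts_sigma : cts sigma. Proof. exact: ac_cts ac_sigma. Qed.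

Lemma mode1_cts : cts mode1.
Proof. by apply: cts_comp => // x _; exact: continuous_cos. Qed.

Lemma mode2_cts : cts mode2.
Proof. by apply: cts_comp => // x _; exact: continuous_sin. Qed.

Let c1 := mode1_cts.
Let c2 := mode2_cts.

Lemma flux_mode1 : flux mode1 (fun x => - mode2 x).
Proof.
split; last exact: ctsN.
have := ac_comp (h := cos) (h' := fun y => - sin y) ac_sigma rho_cts
  (fun x _ => is_derive_cos _) (ctsN c2).
by apply: ac_ext => // x _; rewrite mulrC.
Qed.

Lemma flux_mode2 : flux mode2 mode1.
Proof.
split => //.
have := ac_comp (h := sin) (h' := cos) ac_sigma rho_cts
  (fun x _ => is_derive_sin _) c1.
by apply: ac_ext => // x _; rewrite mulrC.
Qed.

Lemma mode1_0 : mode1 0 = 1. Proof. by rewrite /mode1 /sigma prim0 cos0. Qed.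
Lemma mode2_0 : mode2 0 = 0. Proof. by rewrite /mode2 /sigma prim0 sin0. Qed.
Lemma mode1_T : mode1 T = -1. Proof. by rewrite /mode1 /sigma rho_pi cospi. Qed.
Lemma mode2_T : mode2 T = 0. Proof. by rewrite /mode2 /sigma rho_pi sinpi. Qed.

Lemma mode_sqr x : mode1 x ^+ 2 + mode2 x ^+ 2 = 1.
Proof. exact: cos2Dsin2. Qed.

(** Integration by parts of cos s with itself and with sin s gives orthogonality and equal norms;
    cos^2 + sin^2 = 1 gives the sum pi of the squared norms. *)
Lemma ip_mode : [/\ ip mode1 mode1 = pi / 2, ip mode2 mode2 = pi / 2 &
  ip mode1 mode2 = 0].
Proof.
have := ip_by_parts flux_mode1 flux_mode2.
have := ip_by_parts flux_mode1 flux_mode1.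
rewrite mode1_0 mode1_T mode2_0 mode2_T.
rewrite (ipC mode1 (fun x => _)) !ipNl// (ipC mode2 mode1).
have : ip mode1 mode1 + ip mode2 mode2 = pi.
  rewrite /ip -primD//; [|by apply: cts_intg; solve_cts..].
  by rewrite -[RHS]rho_pi; apply: eq_prim => // x _;
    rewrite -mulrDr -!expr2 mode_sqr mulr1.
by move=> *; split; lra.
Qed.

(* Represent z (t) as the pairing of the derivative of z with the step kernel
   sgn (t - x) / 2 minus its lowest harmonic (2 / pi) sin (sigma t - sigma x). *)
Lemma antiperiodic_sup_bound z zeta : flux z zeta -> z T = - z 0 ->
  ip z mode1 = 0 -> ip z mode2 = 0 ->
  forall t, `[0, T]%classic t -> z t ^+ 2 <= (pi / 4 - 2 / pi) * ip zeta zeta.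
Proof.
move=> fz zT z1 z2 t tT; have [[az cz] fzc] := (fz, flux_cts fz).
have [n11 n22 n12] := ip_mode.
have TT : `[0, T]%classic (T : R) by exact: itv0T_T.
have zm1 : ip zeta mode1 = 0.
  have := ip_by_parts fz flux_mode1; rewrite mode1_0 mode1_T zT (ipC z).
  by rewrite ipNl// (ipC mode2) z2; lra.
have zm2 : ip zeta mode2 = 0.
  have := ip_by_parts fz flux_mode2; rewrite mode2_0 mode2_T z1; lra.
pose a : R := 2 / pi; pose e1 := mode1 t; pose e2 := mode2 t.
(* [S x] is sin (sigma t - sigma x); [zeta] is orthogonal to it by [zm1] and [zm2], so no mixed term
   appears in [uu]. *)
pose S x := e2 * mode1 x + (- e1) * mode2 x.
have cS : cts S by rewrite /S; solve_cts.
have fC : flux (fun x => e1 * mode1 x + e2 * mode2 x) S.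
  have [ac1 _] := fluxD (fluxZ e1 flux_mode1) (fluxZ e2 flux_mode2).
  by split => //; apply: ac_ext ac1 => // x _; rewrite /S; ring.
have PS u : `[0, T]%classic u ->
    P S u = (e1 * mode1 u + e2 * mode2 u) - e1.
  by move=> uT; rewrite (fC.1.2 u uT) mode1_0 mode2_0 mulr1 mulr0 addr0 addrAC subrr add0r.
have Pz u : `[0, T]%classic u -> P zeta u = z u - z 0.
  by move=> uT; rewrite (az.2 u uT) addrAC subrr add0r.
rewrite mulrC; apply: quad_form_discr => s r.
pose u x := s * zeta x + r * a * S x.
have cu : cts u by rewrite /u; solve_cts.
have Pu v : `[0, T]%classic v -> P u v = s * P zeta v + r * a * P S v.
  by move=> vT; rewrite /u PD ?PZ//; solve_cts.
have uu : P (fun x => u x ^+ 2) T = s ^+ 2 * ip zeta zeta + r ^+ 2 * a ^+ 2 * (pi / 2).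
  have -> : P (fun x => u x ^+ 2) T = ip u u
    by rewrite /P /ip; apply: eq_prim => // x _; rewrite expr2.
  have iSl g : cts g -> ip S g = e2 * ip mode1 g - e1 * ip mode2 g.
    move=> cg; rewrite /S ipDl ?ipZl//; [ring|solve_cts..].
  have iul g : cts g -> ip u g = s * ip zeta g + r * a * ip S g.
    by move=> cg; rewrite /u ipDl ?ipZl//; solve_cts.
  rewrite iul// (ipC zeta) (ipC S u) !iul// (ipC zeta S) !iSl//.
  rewrite (ipC mode1 zeta) (ipC mode2 zeta) zm1 zm2 (ipC mode1 S) (ipC mode2 S) !iSl//.
  rewrite (ipC mode2 mode1) n11 n22 n12.
  have := mode_sqr t; rewrite -/e1 -/e2 => E.
  transitivity (s ^+ 2 * ip zeta zeta + r ^+ 2 * a ^+ 2 * (pi / 2 * (e1 ^+ 2 + e2 ^+ 2))).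
    by ring.
  by rewrite E mulr1.
(* For k = 1 and k = -1, [g k] is (u + k r / 2)^2. Integrated with k = -1 over [0, t] and k = 1 over
   [t, T], it gives exactly the quadratic form in (s, r) whose nonnegativity is required. *)
pose g (k : R) x := u x ^+ 2 + (k * r * u x + r ^+ 2 / 4 * 1).
have cg k : cts (g k) by rewrite /g; solve_cts.
have g0 k x : k ^+ 2 = 1 -> 0 <= g k x.
  move=> k2; rewrite /g.
  have -> : u x ^+ 2 + (k * r * u x + r ^+ 2 / 4 * 1) =
      (u x + k * r / 2) ^+ 2 + (1 - k ^+ 2) * (r ^+ 2 / 4) by field.
  by rewrite k2 subrr mul0r addr0 sqr_ge0.
have rg0 k x : k ^+ 2 = 1 -> `[0, T]%classic x -> 0 <= rho x * g k x.
  by move=> k2 xT; rewrite mulr_ge0 ?rho_ge0 ?g0.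
have P1 v : P (fun=> 1) v = prim rho v.
  by rewrite /P; congr prim; apply/funext => x; rewrite mulr1.
have Pg k v : `[0, T]%classic v ->
    P (g k) v = P (fun x => u x ^+ 2) v + k * r * P u v + r ^+ 2 / 4 * prim rho v.
  move=> vT; have cu2 : cts (fun x => u x ^+ 2) by exact: ctsX.
  have cku : cts (fun x => k * r * u x) by solve_cts.
  have c1' : cts (fun=> 1 : R) by exact: cts_cst.
  have cr : cts (fun=> r ^+ 2 / 4 * 1) by exact: cts_cst.
  rewrite /g (PD vT cu2 (ctsD cku cr)) (PD vT cku cr) (PZ _ vT cu) (PZ _ vT c1').
  by rewrite P1 addrA.
have k1 : (-1) ^+ 2 = 1 :> R by rewrite sqrrN expr1n.
have k2 : 1 ^+ 2 = 1 :> R by rewrite expr1n.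
have h1 : 0 <= P (g (-1)) t.
  by rewrite /P; apply: prim_ge0 => [|x xT]; [exact: itvT_le|exact: rg0].
have h2 : P (g 1) t <= P (g 1) T.
  rewrite /P; apply: prim_mono => // [|x xT]; last exact: rg0.
  by apply: cts_intg; apply: ctsM.
move: h1 h2; rewrite !Pg// uu rho_pi !Pu// !Pz// !PS// mode1_T mode2_T zT.
have E : e1 * mode1 t + e2 * mode2 t = 1 by rewrite -[RHS](mode_sqr t) !expr2.
rewrite E => h1 h2.
have -> : s ^+ 2 * ip zeta zeta - 2 * s * r * z t + r ^+ 2 * (pi / 4 - 2 / pi) =
  (s ^+ 2 * ip zeta zeta + r ^+ 2 * a ^+ 2 * (pi / 2) + r * (s * (- z 0 - z 0) +
   r * a * (e1 * -1 + e2 * 0 - e1)) + r ^+ 2 / 4 * pi) -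
  2 * r * (s * (z t - z 0) + r * a * (1 - e1)).
  have pn0 : pi != 0 :> R by rewrite gt_eqF ?pi_gt0.
  by rewrite /a; move: (pi : R) pn0 => q q0; field.
lra.
Qed.
End sturm_liouville.

(** A zero determinant would put (d, -b) and (c, -a) in the kernel, so all entries would vanish and
    (1, 0) would be a nonzero kernel vector. *)
Lemma solve_2x2 (F : fieldType) (a b c d : F) :
  (forall x y, x * a + y * c = 0 -> x * b + y * d = 0 -> x = 0 /\ y = 0) ->
  forall r s, exists x y, x * a + y * c = r /\ x * b + y * d = s.
Proof.
move=> inj r s; have [D0|D0] := eqVneq (a * d - b * c) 0.
  have [|| d0 /eqP] := inj d (- b); [rewrite -[RHS]D0; ring|ring|].
  rewrite oppr_eq0 => /eqP b0; have [|| c0 /eqP] := inj c (- a).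
  - ring.
  - by rewrite b0 d0 !mulr0 addr0.
  - rewrite oppr_eq0 => /eqP a0; have [||/eqP] := inj 1 0.
    + by rewrite a0 c0 !mulr0 addr0.
    + by rewrite b0 d0 !mulr0 addr0.
    + by rewrite oner_eq0.
exists ((r * d - s * c) / (a * d - b * c)), ((a * s - b * r) / (a * d - b * c)).
by split; field.
Qed.

(** Here [p] stands for pi, J for the integral of the squared potential, m for its mean, X for its
    integral against zeta, Z for the integral of zeta^2 and A for the energy of z. If m < 1, then X
    > 0 and Z <= A / 4 <= X / 2, so Cauchy-Schwarz yields X^2 <= X^2 (1 + m) / 2, a contradiction.
    Hence m >= 1, which makes X = 0, then A = 0, m = 1 and J = p. *)
Lemma rigidity_arithmetic (R : realFieldType) (J X A Z m k p : R) :
  0 < p -> J <= p -> 0 <= J - m ^+ 2 * p -> 0 <= A -> k < 1 / 2 ->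
  X = p - m * p -> A * (1 - k) <= X -> 0 <= Z -> Z <= k / 2 * A ->
  X ^+ 2 <= (J - m ^+ 2 * p) * Z -> A = 0 /\ J = p.
Proof.
move=> p0 Jp V0 A0 k1 low XA Z0 Zk cs.
have k2 : 0 < 1 - k by lra.
have X0 : 0 <= X by apply: le_trans XA; rewrite mulr_ge0// ltW.
have m1 : 1 <= m.
  rewrite leNgt; apply/negP => m1.
  have Xpos : 0 < X by rewrite low -[ltRHS](_ : (1 - m) * p = _) ?mulr_gt0 ?subr_gt0//; ring.
  have V1 : J - m ^+ 2 * p <= p - m ^+ 2 * p by lra.
  have Z2 : Z <= X / 2.
    have := ler_wpM2l A0 (ltW k1); lra.
  have : X ^+ 2 <= (p - m ^+ 2 * p) * (X / 2).
    by apply: (le_trans cs); apply: ler_pM.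
  rewrite (_ : _ * _ = X ^+ 2 * ((1 + m) / 2)); last by rewrite low; field.
  have X2 : 0 < X ^+ 2 by rewrite exprn_gt0.
  by rewrite -[leLHS]mulr1 ler_pM2l//; lra.
have X00 : X = 0.
  apply/eqP; rewrite eq_le X0 andbT low -[leLHS](_ : (1 - m) * p = _); last by ring.
  by rewrite pmulr_lle0//; lra.
have m11 : m = 1.
  move/eqP: X00; rewrite low -[X in X - _]mul1r -mulrBl mulf_eq0 (gt_eqF p0) orbF.
  by rewrite subr_eq0 => /eqP.
split; last by apply/eqP; rewrite eq_le Jp /=; move: V0; rewrite m11; lra.
by apply/eqP; rewrite eq_le A0 andbT -(pmulr_lle0 _ k2) -X00.
Qed.

(** * Rigidity for Hill's equation *)

Section hill.
Context {R : realType}.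
Notation T := (2 * pi).
(* kappa stands for b'' + b / 4. *)
Variables b beta kappa : R -> R.
Hypothesis b_gt0 : forall x, `[0, T]%classic x -> 0 < b x.
Hypothesis acb : ac b beta.
Hypothesis acbeta : ac beta (fun x => kappa x - b x / 4).
Hypothesis Lk : L2 kappa.
Hypothesis bT : b T = b 0.
Hypothesis betaT : beta T = beta 0.
Hypothesis b_norm : prim (fun x => (b x)^-1 ^+ 2) T = pi.
Implicit Types (f g : R -> R) (x : R).

Let ib x := (b x)^-1.
Let rho x := (b x)^-1 ^+ 2.
Let ipr := ip rho.

Let cb : cts b. Proof. exact: ac_cts acb. Qed.
Let cbeta : cts beta. Proof. exact: ac_cts acbeta. Qed.
Let b_neq0 x : `[0, T]%classic x -> b x != 0.
Proof. by move=> xT; rewrite gt_eqF// b_gt0. Qed.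
Let cib : cts ib. Proof. by apply: ctsV. Qed.
Let crho : cts rho. Proof. exact: ctsX. Qed.
Let rho_ge0 x : `[0, T]%classic x -> 0 <= rho x.
Proof. by rewrite sqr_ge0. Qed.
Let TT : `[0, T]%classic (T : R). Proof. exact: itv0T_T. Qed.
Let T0 : `[0, T]%classic (0 : R). Proof. exact: itv0T_0. Qed.

(** The solutions of w'' + w / 4 = 0, with coefficient vector [p]. *)
Definition wave (p : R * R) x := p.1 * cos (x / 2) + p.2 * sin (x / 2).
Definition dwave (p : R * R) x := p.1 * (- sin (x / 2) / 2) + p.2 * (cos (x / 2) / 2).

Let is_derive_half x : is_derive x 1 (fun x : R => x / 2) 2^-1.
Proof.
have H : is_derive x 1 (fun y : R => 2^-1 *: y) (2^-1 *: 1).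
  by apply: is_deriveZ.
rewrite (_ : (fun x : R => x / 2) = (fun y : R => 2^-1 *: y)); last first.
  by apply/funext => y; rewrite mulrC.
by apply: (is_derive_eq H); rewrite /GRing.scale/= mulr1.
Qed.

Let cont_half : continuous (fun x : R => x / 2).
Proof.
move=> x; apply/differentiable_continuous/derivable1_diffP.
by have [] := is_derive_half x.
Qed.

Let ac_cosh : ac (fun x : R => cos (x / 2)) (fun x => - sin (x / 2) / 2).
Proof.
apply: ac_smooth.
  by move=> x; exact: (is_derive1_comp (is_derive_cos _) (is_derive_half x)).
move=> x; apply: cvgM; last exact: cvg_cst.
apply: cvgN; apply: continuous_comp; first exact: cont_half.
exact: continuous_sin.
Qed.

Let ac_sinh : ac (fun x : R => sin (x / 2)) (fun x => cos (x / 2) / 2).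
Proof.
apply: ac_smooth.
  by move=> x; exact: (is_derive1_comp (is_derive_sin _) (is_derive_half x)).
move=> x; apply: cvgM; last exact: cvg_cst.
apply: continuous_comp; first exact: cont_half.
exact: continuous_cos.
Qed.

Lemma ac_wave p : ac (wave p) (dwave p).
Proof. exact: acD (acZ _ ac_cosh) (acZ _ ac_sinh). Qed.

Lemma ac_dwave p : ac (dwave p) (fun x => - wave p x / 4).
Proof.
apply: ac_ext (acD (acZ (- p.1 / 2) ac_sinh) (acZ (p.2 / 2) ac_cosh)) => x _.
  by rewrite /dwave; ring.
by rewrite /wave; field.
Qed.

Let halfT : T / 2 = pi :> R. Proof. by field. Qed.

Lemma wave_T p : wave p T = - wave p 0.
Proof. by rewrite /wave halfT mul0r cospi sinpi cos0 sin0; ring. Qed.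

Lemma dwave_T p : dwave p T = - dwave p 0.
Proof. by rewrite /dwave halfT mul0r cospi sinpi cos0 sin0; ring. Qed.

(* In the variable s with ds = dx / b^2, the functions sol p solve Hill's
   equation y'' + (b^3 kappa) y = 0 and sol_flux p is the s-derivative of sol p. *)
Let sol p x := wave p x * ib x.
Let sol_flux p x := b x * dwave p x - wave p x * beta x.

Let cwave p : cts (wave p). Proof. exact: ac_cts (ac_wave p). Qed.
Let cdwave p : cts (dwave p). Proof. exact: ac_cts (ac_dwave p). Qed.

Let flux_sol p : flux rho (sol p) (sol_flux p).
Proof.
have cw := @cwave p; have cd := @cdwave p; split; last by rewrite /sol_flux; solve_cts.
apply: ac_ext (acM (ac_wave p) (acV acb cbeta b_neq0)) => // x xT.
by rewrite /sol_flux /rho; field; exact: b_neq0.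
Qed.

(** The flux is the Wronskian of [b] and [wave p]; in its derivative the products of first
    derivatives and the terms in b / 4 cancel. *)
Let ac_sol_flux p : ac (sol_flux p) (fun x => - (kappa x * wave p x)).
Proof.
apply: ac_ext (acB (acM acb (ac_dwave p)) (acM (ac_wave p) acbeta)) => // x _.
by field.
Qed.

Let sol_T p : sol p T = - sol p 0.
Proof. by rewrite /sol wave_T /ib bT mulNr. Qed.

Let sol_flux_T p : sol_flux p T = - sol_flux p 0.
Proof. by rewrite /sol_flux wave_T dwave_T bT betaT; ring. Qed.

(* The integral of p f / b against ds, where p = b^3 kappa. *)
Let N f := prim (fun x => kappa x * f x) T.

Let intg_kM f : cts f -> intg (fun x => kappa x * f x).
Proof. by move=> cf; apply: L2_intgM => //; exact: L2_cts. Qed.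

Let ND f g : cts f -> cts g -> N (fun x => f x + g x) = N f + N g.
Proof.
move=> cf cg; rewrite /N -primD//; [|exact: intg_kM..].
by apply: eq_prim => // x _; rewrite mulrDr.
Qed.

Let N_ext f g : (forall x, `[0, T]%classic x -> f x = g x) -> N f = N g.
Proof. by move=> fg; apply: eq_prim => // x xT; rewrite fg. Qed.

(** Hill's equation in weak form: the boundary terms of the integration by parts cancel because flux
    and test function are both antiperiodic. *)
Let sol_weak p f phi : flux rho f phi -> f T = - f 0 ->
  ipr (sol_flux p) phi = N (fun x => wave p x * f x).
Proof.
move=> ff fT; have cf := flux_cts ff; case: ff => af cphi.
have := ac_prim_T (acM (ac_sol_flux p) af).
rewrite sol_flux_T fT mulrNN subrr.
have cF : cts (sol_flux p) := ac_cts (ac_sol_flux p).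
have cw := @cwave p.
have i1 : intg (fun x => kappa x * (wave p x * f x)) by apply: intg_kM; solve_cts.
have i2 : intg (fun x => rho x * (sol_flux p x * phi x)) by apply: cts_intg; solve_cts.
move=> E; apply/eqP; rewrite -subr_eq0 -E /ipr /ip /N -primB//; apply/eqP.
by apply: eq_prim => // x _; ring.
Qed.

(** With ds = b^-2 dx, this is the integral against ds of the square of the potential b^3 kappa. *)
Let J := prim (fun x => (b x ^+ 2 * kappa x) ^+ 2) T.

Let Lbk : L2 (fun x => b x ^+ 2 * kappa x).
Proof. by apply: L2_ctsM => //; exact: ctsX. Qed.

(* Pointwise, 2 b kappa <= (b^2 kappa)^2 + rho. *)
Let N_bound q M : J <= pi -> cts q ->
  (forall x, `[0, T]%classic x -> 0 <= q x <= M) ->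
  N (fun x => b x * q x) <= M * pi.
Proof.
move=> Jpi cq q0M.
have M0 : 0 <= M by have /andP[/le_trans h /h] := q0M 0 T0.
apply: (@le_trans _ _ (prim (fun x => M / 2 * ((b x ^+ 2 * kappa x) ^+ 2 + rho x)) T)).
  apply: le_prim => //; first by apply: intg_kM; solve_cts.
    by apply: intgZ; apply: intgD; [exact: L2_intg_sq|exact: cts_intg].
  move=> x xT; have /andP[q0 qM] := q0M x xT.
  have bk : kappa x * (b x * q x) = q x * ((b x ^+ 2 * kappa x) * ib x).
    by rewrite /ib; field; exact: b_neq0.
  rewrite bk /rho -/(ib x); move: (b x ^+ 2 * kappa x) (ib x) => s t.
  have st : s * t <= (s ^+ 2 + t ^+ 2) / 2 by have := sqr_ge0 (s - t); nra.
  have := ler_wpM2l q0 st; have := ler_wpM2r (addr_ge0 (sqr_ge0 s) (sqr_ge0 t)) qM.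
  lra.
rewrite primZ//; last by apply: intgD; [exact: L2_intg_sq|exact: cts_intg].
rewrite primD//; [|exact: L2_intg_sq|exact: cts_intg].
rewrite b_norm -/J mulrAC -mulrA ler_wpM2l//; lra.
Qed.

Let K : R := pi / 4 - 2 / pi.

Let Kpi : K * pi < 1 / 2.
Proof.
have -> : K * pi = pi ^+ 2 / 4 - 2.
  have : pi != 0 :> R by rewrite gt_eqF ?pi_gt0.
  by rewrite /K; move: (pi : R) => q q0; field.
by have := @pi_sqr_lt10 R; lra.
Qed.

Let e1 := mode1 rho.
Let e2 := mode2 rho.
Let ce1 : cts e1. Proof. exact: mode1_cts. Qed.
Let ce2 : cts e2. Proof. exact: mode2_cts. Qed.
Let csol p : cts (sol p). Proof. exact: flux_cts (flux_sol p). Qed.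
Let csol_flux p : cts (sol_flux p). Proof. exact: (flux_sol p).2. Qed.

Let wave_sol p x : `[0, T]%classic x -> wave p x = b x * sol p x.
Proof. by move=> xT; rewrite /sol /ib; field; exact: b_neq0. Qed.

Let iprC f g : ipr f g = ipr g f. Proof. exact: ipC. Qed.
Let iprDl f g h : cts f -> cts g -> cts h ->
  ipr (fun x => f x + g x) h = ipr f h + ipr g h.
Proof. exact: ipDl. Qed.
Let iprBl f g h : cts f -> cts g -> cts h ->
  ipr (fun x => f x - g x) h = ipr f h - ipr g h.
Proof. exact: ipBl. Qed.
Let iprNl f g : cts f -> cts g -> ipr (fun x => - f x) g = - ipr f g.
Proof. exact: ipNl. Qed.
Let iprZl (k : R) f g : cts f -> cts g -> ipr (fun x => k * f x) g = k * ipr f g.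
Proof. exact: ipZl. Qed.

Let ipr_by_parts f g phi psi : flux rho f phi -> flux rho g psi ->
  ipr phi g + ipr f psi = f T * g T - f 0 * g 0.
Proof. exact: ip_by_parts. Qed.

Let sup_bound z zeta : flux rho z zeta -> z T = - z 0 ->
  ipr z e1 = 0 -> ipr z e2 = 0 ->
  forall x, `[0, T]%classic x -> z x ^+ 2 <= K * ipr zeta zeta.
Proof. exact: antiperiodic_sup_bound. Qed.

(** A solution orthogonal to both modes, tested against itself, has energy Q <= K pi Q with K pi < 1
    / 2, so it vanishes; evaluating its wave at 0 and pi kills both coefficients. *)
Let sol_inj p : J <= pi -> ipr (sol p) e1 = 0 -> ipr (sol p) e2 = 0 -> p = (0, 0).
Proof.
move=> Jpi p1 p2; have cs := @csol p; have sup := sup_bound (flux_sol p) (sol_T p) p1 p2.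
set Q := ipr _ _ in sup; have Q0 : 0 <= Q by exact: ip_ge0.
have : Q <= K * Q * pi.
  rewrite {1}/Q (sol_weak p (flux_sol p) (sol_T p)).
  rewrite (@N_ext _ (fun x => b x * (sol p x) ^+ 2)); last first.
    by move=> x xT; rewrite wave_sol// expr2 mulrA.
  by apply: N_bound => // [|x xT]; [exact: ctsX|rewrite sqr_ge0 sup].
rewrite mulrAC => QK.
have Q00 : Q = 0 by apply/eqP; rewrite eq_le Q0 andbT; have := ler_wpM2r Q0 (ltW Kpi); lra.
have s0 x : `[0, T]%classic x -> wave p x = 0.
  move=> xT; have := sup x xT; rewrite Q00 mulr0 => h.
  rewrite wave_sol//; suff -> : sol p x = 0 by rewrite mulr0.
  by apply/eqP; rewrite -sqrf_eq0 eq_le h sqr_ge0.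
have piT : `[0, T]%classic (pi : R).
  by rewrite /= in_itv/=; have := pi_gt0 R; lra.
have := s0 _ T0; have := s0 _ piT; rewrite /wave mul0r cos0 sin0 cos_pihalf sin_pihalf.
by rewrite !mulr1 !mulr0 add0r addr0; case: p {p1 p2 cs sup Q Q0 QK Q00 s0} => x y /= -> ->.
Qed.

Let sol_lin p x : sol p x = p.1 * sol (1, 0) x + p.2 * sol (0, 1) x.
Proof. by rewrite /sol /wave /=; ring. Qed.

Let ip_sol_lin p g : cts g ->
  ipr (sol p) g = p.1 * ipr (sol (1, 0)) g + p.2 * ipr (sol (0, 1)) g.
Proof.
move=> cg; have c10 := @csol (1, 0); have c01 := @csol (0, 1).
rewrite -(iprZl _ c10 cg) -(iprZl _ c01 cg) -iprDl//; [|by solve_cts..].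
by apply: ip_ext => // x _; rewrite sol_lin.
Qed.

(** Projection from the solution space to the pair of products with the modes is a linear map in two
    dimensions; being injective, it is onto. *)
Let sol_coef (r s : R) : J <= pi ->
  exists p, ipr (sol p) e1 = r /\ ipr (sol p) e2 = s.
Proof.
move=> Jpi.
have [x y h1 h2|x [y [xr ys]]] := @solve_2x2 R (ipr (sol (1, 0)) e1)
    (ipr (sol (1, 0)) e2) (ipr (sol (0, 1)) e1) (ipr (sol (0, 1)) e2) _ r s.
  have := @sol_inj (x, y) Jpi.
  by rewrite (ip_sol_lin (x, y) ce1) (ip_sol_lin (x, y) ce2) => /(_ h1 h2) [-> ->].
by exists (x, y); rewrite (ip_sol_lin (x, y) ce1) (ip_sol_lin (x, y) ce2).
Qed.

Lemma hill_rigidity : J <= pi -> J = pi /\ exists p q : R * R,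
  forall x, `[0, T]%classic x -> b x ^+ 2 = wave p x ^+ 2 + wave q x ^+ 2.
Proof.
move=> Jpi.
(* These solutions have the same products with the modes as cos s and sin s, so the remainders [z1]
   and [z2] are orthogonal to both modes. *)
have [p [p1 p2]] := sol_coef (pi / 2) 0 Jpi.
have [q [q1 q2]] := sol_coef 0 (pi / 2) Jpi.
have [n11 n22 n12] : [/\ ipr e1 e1 = pi / 2, ipr e2 e2 = pi / 2 & ipr e1 e2 = 0].
  exact: ip_mode.
have f1 : flux rho e1 (fun x => - e2 x) by exact: flux_mode1.
have f2 : flux rho e2 e1 by exact: flux_mode2.
have [e10 e1T] : e1 0 = 1 /\ e1 T = -1 by split; [exact: mode1_0|exact: mode1_T].
have [e20 e2T] : e2 0 = 0 /\ e2 T = 0 by split; [exact: mode2_0|exact: mode2_T].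
have e12 x : e1 x ^+ 2 + e2 x ^+ 2 = 1 by exact: mode_sqr.
have e1A : e1 T = - e1 0 by rewrite e10 e1T.
have e2A : e2 T = - e2 0 by rewrite e20 e2T oppr0.
have [csp csq] := (@csol p, @csol q); have [cfp cfq] := (@csol_flux p, @csol_flux q).
pose z1 x := sol p x - e1 x; pose w1 x := sol_flux p x - - e2 x.
pose z2 x := sol q x - e2 x; pose w2 x := sol_flux q x - e1 x.
have F1 : flux rho z1 w1 by exact: fluxB (flux_sol p) f1.
have F2 : flux rho z2 w2 by exact: fluxB (flux_sol q) f2.
have [[cz1 cz2] [cw1 cw2]] := ((flux_cts F1, flux_cts F2), (F1.2, F2.2)).
have z1A : z1 T = - z1 0 by rewrite /z1 sol_T e1A; ring.
have z2A : z2 T = - z2 0 by rewrite /z2 sol_T e2A; ring.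
have [r11 r12] : ipr z1 e1 = 0 /\ ipr z1 e2 = 0.
  by rewrite /z1 !iprBl// p1 p2 n11 n12 !subrr.
have [r21 r22] : ipr z2 e1 = 0 /\ ipr z2 e2 = 0.
  by rewrite /z2 !iprBl// q1 q2 n22 (iprC e2) n12 !subrr.
pose A11 := ipr w1 w1; pose A22 := ipr w2 w2; pose A12 := ipr w1 w2.
have [A110 A220] : 0 <= A11 /\ 0 <= A22 by split; exact: ip_ge0.
pose A := A11 + A22.
pose zeta x := e1 x * z1 x + e2 x * z2 x.
have czeta : cts zeta by rewrite /zeta; solve_cts.
have w1e2 : ipr w1 e2 = 0.
  by have := ipr_by_parts F1 f2; rewrite r11 e20 e2T !mulr0 subrr addr0.
have w2e1 : ipr w2 e1 = 0.
  have := ipr_by_parts F2 f1; rewrite (iprC z2) iprNl// (iprC e2) r22 e10 e1T z2A.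
  by rewrite oppr0 addr0 mulrNN subrr.
(* Hill's equation for [sol p] is tested against cos s, that for [sol q] against sin s, and the
   results are added. *)
have low : N (fun x => b x * zeta x) = pi - N b.
  have h1 := sol_weak p f1 e1A; have h2 := sol_weak q f2 e2A.
  have l1 : ipr (sol_flux p) (fun x => - e2 x) = pi / 2.
    rewrite (_ : ipr _ _ = ipr (fun x => w1 x - e2 x) (fun x => - e2 x)); last first.
      by apply: ip_ext => // x _; rewrite /w1; ring.
    rewrite iprC iprNl//; last by solve_cts.
    by rewrite iprC iprBl// w1e2 n22; ring.
  have l2 : ipr (sol_flux q) e1 = pi / 2.
    rewrite (_ : ipr _ _ = ipr (fun x => w2 x + e1 x) e1); last first.
      by apply: ip_ext => // x _; rewrite /w2; ring.
    by rewrite iprDl// w2e1 n11 add0r.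
  have [cwp cwq] := (@cwave p, @cwave q).
  have : N (fun x => wave p x * e1 x + wave q x * e2 x) = pi.
    by rewrite ND; [rewrite -h1 -h2 l1 l2; field|solve_cts..].
  move=> <-; rewrite (@N_ext (fun x => wave p x * e1 x + wave q x * e2 x)
    (fun x => b x * zeta x + b x)); first by rewrite ND ?addrK//; solve_cts.
  move=> x xT; rewrite !wave_sol// /zeta /z1 /z2.
  by rewrite -[X in _ = _ + X](mulr1 (b x)) -(e12 x); ring.
(* The same two equations are tested against the remainders [z1] and [z2]. *)
have high : A = N (fun x => b x * zeta x) + N (fun x => b x * (z1 x ^+ 2 + z2 x ^+ 2)).
  have h1 := sol_weak p F1 z1A; have h2 := sol_weak q F2 z2A.
  have l1 : ipr (sol_flux p) w1 = A11.
    rewrite (_ : ipr _ _ = ipr (fun x => w1 x - e2 x) w1); last first.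
      by apply: ip_ext => // x _; rewrite /w1; ring.
    by rewrite iprBl// (iprC e2) w1e2 subr0.
  have l2 : ipr (sol_flux q) w2 = A22.
    rewrite (_ : ipr _ _ = ipr (fun x => w2 x + e1 x) w2); last first.
      by apply: ip_ext => // x _; rewrite /w2; ring.
    by rewrite iprDl// (iprC e1) w2e1 addr0.
  have [cwp cwq] := (@cwave p, @cwave q).
  rewrite /A -l1 -l2 h1 h2 -!ND; [|by solve_cts..].
  by apply: N_ext => x xT; rewrite !wave_sol// /zeta /z1 /z2; ring.
have s1 := sup_bound F1 z1A r11 r12; have s2 := sup_bound F2 z2A r21 r22.
rewrite -/A11 in s1; rewrite -/A22 in s2.
have Nz2 : N (fun x => b x * (z1 x ^+ 2 + z2 x ^+ 2)) <= K * A * pi.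
  apply: N_bound => // [|x xT]; first by solve_cts.
  by rewrite addr_ge0 ?sqr_ge0//= mulrDr lerD ?s1 ?s2.
(* With x frozen, zeta x is the value at x of a fixed combination of [z1] and [z2], which is still
   antiperiodic and orthogonal to the modes, so the pointwise bound applies to it. *)
have zeta_sup x : `[0, T]%classic x -> zeta x ^+ 2 <=
    K * (e1 x ^+ 2 * A11 + 2 * (e1 x * e2 x) * A12 + e2 x ^+ 2 * A22).
  move=> xT; have Fx := fluxD (fluxZ (e1 x) F1) (fluxZ (e2 x) F2).
  have hT : e1 x * z1 T + e2 x * z2 T = - (e1 x * z1 0 + e2 x * z2 0).
    by rewrite z1A z2A; ring.
  have iw g : cts g -> ipr (fun y => e1 x * w1 y + e2 x * w2 y) g =
      e1 x * ipr w1 g + e2 x * ipr w2 g.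
    by move=> cg; rewrite iprDl ?iprZl//; solve_cts.
  have iz g : cts g -> ipr (fun y => e1 x * z1 y + e2 x * z2 y) g =
      e1 x * ipr z1 g + e2 x * ipr z2 g.
    by move=> cg; rewrite iprDl ?iprZl//; solve_cts.
  have h1 : ipr (fun y => e1 x * z1 y + e2 x * z2 y) e1 = 0.
    by rewrite iz// r11 r21 !mulr0 addr0.
  have h2 : ipr (fun y => e1 x * z1 y + e2 x * z2 y) e2 = 0.
    by rewrite iz// r12 r22 !mulr0 addr0.
  apply: (le_trans (sup_bound Fx hT h1 h2 xT)).
  have cw : cts (fun y => e1 x * w1 y + e2 x * w2 y) by solve_cts.
  rewrite iw// (iprC w1) (iprC w2) !iw// -/A11 -/A22 (iprC w2 w1) -/A12.
  by rewrite le_eqVlt; apply/orP; left; apply/eqP; ring.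
(* Integration against ds turns e1^2 and e2^2 into pi / 2 and removes the mixed term, which gains a
   factor 1 / 2 over the total length pi. *)
have zeta2 : ipr zeta zeta <= K * (pi / 2) * A.
  pose B x := K * A11 * (e1 x * e1 x) + (2 * K * A12 * (e1 x * e2 x) +
    K * A22 * (e2 x * e2 x)).
  have cB : cts B by rewrite /B; solve_cts.
  have i11 : intg (fun x => rho x * (e1 x * e1 x)) by apply: cts_intg; solve_cts.
  have i12 : intg (fun x => rho x * (e1 x * e2 x)) by apply: cts_intg; solve_cts.
  have i22 : intg (fun x => rho x * (e2 x * e2 x)) by apply: cts_intg; solve_cts.
  have -> : K * (pi / 2) * A = prim (fun x => rho x * B x) T.
    transitivity (K * A11 * ipr e1 e1 + (2 * K * A12 * ipr e1 e2 + K * A22 * ipr e2 e2)).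
      by rewrite n11 n12 n22 /A; ring.
    rewrite -(primZ _ (lexx T) i11) -(primZ _ (lexx T) i12) -(primZ _ (lexx T) i22).
    rewrite -(primD (lexx T) (intgZ _ i12) (intgZ _ i22)).
    rewrite -(primD (lexx T) (intgZ _ i11) (intgD (intgZ _ i12) (intgZ _ i22))).
    by apply: eq_prim => // x _; rewrite /B; ring.
  apply: le_prim => //; [by apply: cts_intg; solve_cts..|].
  move=> x xT; rewrite ler_wpM2l ?rho_ge0// -expr2.
  apply: (le_trans (zeta_sup x xT)).
  by rewrite le_eqVlt; apply/orP; left; apply/eqP; rewrite /B; ring.
have pi0 := pi_gt0 R.
(* [m] is the mean of the potential. Cauchy-Schwarz is applied in L2 (ds) to the potential minus [m]
   and to zeta, each carrying a factor 1 / b in terms of dx. Subtracting [m] leaves the pairing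
   unchanged because zeta has mean zero. *)
pose m := N b / pi; have mN : N b = m * pi by rewrite /m divfK// gt_eqF.
have Lib : L2 (fun x => m * ib x) by apply/L2_cts; solve_cts.
have Lf : L2 (fun x => b x ^+ 2 * kappa x - m * ib x) by exact: L2B.
have Lg : L2 (fun x => ib x * zeta x) by apply/L2_cts; solve_cts.
have cs := cauchy_schwarz Lf Lg.
have f2E : prim (fun x => (b x ^+ 2 * kappa x - m * ib x) ^+ 2) T = J - m ^+ 2 * pi.
  rewrite (@eq_prim _ _ (fun x => ((b x ^+ 2 * kappa x) ^+ 2 +
    - (2 * m) * (kappa x * b x)) + m ^+ 2 * rho x))//; last first.
    by move=> x xT; rewrite /rho /ib; field; exact: b_neq0.
  have i1 := L2_intg_sq Lbk; have i2 := intg_kM cb; have i3 := cts_intg crho.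
  rewrite primD//; [|by apply: intgD => //; exact: intgZ|exact: intgZ].
  rewrite primD//; last exact: intgZ.
  rewrite !primZ// -/J b_norm -/(N b) mN; ring.
have fgE : prim (fun x => (b x ^+ 2 * kappa x - m * ib x) * (ib x * zeta x)) T =
    N (fun x => b x * zeta x).
  rewrite (@eq_prim _ _ (fun x => kappa x * (b x * zeta x) -
      m * (rho x * (e1 x * z1 x) + rho x * (e2 x * z2 x))))//; last first.
    by move=> x xT; rewrite /rho /ib /zeta; field; exact: b_neq0.
  have i1 : intg (fun x => kappa x * (b x * zeta x)) by apply: intg_kM; solve_cts.
  have i2 : intg (fun x => rho x * (e1 x * z1 x)) by apply: cts_intg; solve_cts.
  have i3 : intg (fun x => rho x * (e2 x * z2 x)) by apply: cts_intg; solve_cts.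
  rewrite primB//; last by apply: intgZ; exact: intgD.
  rewrite primZ//; last exact: intgD.
  have y1 : prim (fun x => rho x * (e1 x * z1 x)) T = 0.
    by rewrite -[LHS]/(ipr e1 z1) iprC.
  have y2 : prim (fun x => rho x * (e2 x * z2 x)) T = 0.
    by rewrite -[LHS]/(ipr e2 z2) iprC.
  by rewrite (primD (lexx T) i2 i3) y1 y2 addr0 mulr0 subr0.
have g2E : prim (fun x => (ib x * zeta x) ^+ 2) T = ipr zeta zeta.
  by apply: eq_prim => // x _; rewrite exprMn expr2.
rewrite fgE f2E g2E in cs.
have V0 : 0 <= J - m ^+ 2 * pi.
  by rewrite -f2E; apply: prim_ge0 => // x _; exact: sqr_ge0.
have A0 : 0 <= A by rewrite addr_ge0.
rewrite mN in low; set X := N (fun x => b x * zeta x) in low high cs.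
have XA : A * (1 - K * pi) <= X.
  rewrite mulrBr mulr1 lerBlDr {1}high lerD2l.
  by rewrite (mulrC A) mulrAC.
have Zk : ipr zeta zeta <= K * pi / 2 * A by rewrite -(mulrA K).
have [A00 J0] := rigidity_arithmetic pi0 Jpi V0 A0 Kpi low XA (ip_ge0 rho_ge0 _) Zk cs.
split => //; exists p, q => x xT.
(* Zero energy makes [z1] and [z2] vanish pointwise, so the two solutions are cos s and sin s, and
   their squares add up to 1. *)
have [A11z A22z] : A11 = 0 /\ A22 = 0.
  by move/eqP: A00; rewrite /A paddr_eq0// => /andP[/eqP -> /eqP ->].
have z10 : z1 x = 0.
  apply/eqP; rewrite -sqrf_eq0 eq_le sqr_ge0 andbT.
  by have := s1 x xT; rewrite A11z mulr0.
have z20 : z2 x = 0.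
  apply/eqP; rewrite -sqrf_eq0 eq_le sqr_ge0 andbT.
  by have := s2 x xT; rewrite A22z mulr0.
have s1E : sol p x = e1 x by apply/eqP; rewrite -subr_eq0; apply/eqP.
have s2E : sol q x = e2 x by apply/eqP; rewrite -subr_eq0; apply/eqP.
rewrite (wave_sol p xT) (wave_sol q xT) s1E s2E -[LHS]mulr1 -(e12 x); ring.
Qed.
End hill.

(** * Length of the circle when the potential is constant *)

Section constant_curvature.
Context {R : realType}.
Notation T := (2 * pi).
Implicit Types (f g : R -> R).

(** The reciprocal of [f] is continuous, hence bounded by some M, so [f] is at least 1 / M. *)
Lemma prim_gt0 f : cts f -> (forall x, `[0, T]%classic x -> 0 < f x) -> 0 < prim f T.
Proof.
move=> cf f0; have cV : cts (fun x => (f x)^-1).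
  by apply: ctsV => // x xT; rewrite gt_eqF// f0.
have [M M0 VM] := cts_bounded cV.
apply: (@lt_le_trans _ _ (prim (fun=> M^-1) T)).
  by rewrite prim_cst ?(ltW T_gt0)// mulr_gt0 ?invr_gt0 ?T_gt0.
apply: le_prim => //; [exact/cts_intg/cts_cst|exact: cts_intg|].
move=> x xT; rewrite -[leRHS]invrK lef_pV2 ?posrE ?invr_gt0 ?f0//.
exact: le_trans (ler_norm _) (VM x xT).
Qed.

Variables b beta kappa : R -> R.
Variable r : R.
Hypothesis b_gt0 : forall x, `[0, T]%classic x -> 0 < b x.
Hypothesis acb : ac b beta.
Hypothesis acbeta : ac beta (fun x => kappa x - b x / 4).
Hypothesis r_gt0 : 0 < r.
Hypothesis kappaE : forall x, `[0, T]%classic x -> b x ^+ 3 * kappa x = r ^+ 2.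

(* Both sides solve y'' + r^2 y = 0 with respect to dx / b^2, so that
   sin (x / 2) / b, which has no zero inside the period, is a multiple of sin tau. *)
Lemma constant_curvature_length : r * prim (fun x => (b x)^-1 ^+ 2) T = pi.
Proof.
have b0 x : `[0, T]%classic x -> b x != 0 by move=> xT; rewrite gt_eqF// b_gt0.
have cb := ac_cts acb; have cbeta := ac_cts acbeta.
have crho : cts (fun x => (b x)^-1 ^+ 2) by apply: ctsX; exact: ctsV.
set rho := fun x => _ in crho *.
have rho0 x : `[0, T]%classic x -> 0 < rho x.
  by move=> xT; rewrite exprn_gt0// invr_gt0 b_gt0.
pose tau x := r * prim rho x.
have atau : ac tau (fun x => r * rho x) by apply: acZ; exact/ac_prim/cts_intg.
have ctau' : cts (fun x => r * rho x) by apply: ctsM => //; exact: cts_cst.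
have ctau := ac_cts atau.
pose p : R * R := (0, 1).
have aw := @ac_wave R p; have adw := @ac_dwave R p.
pose y x := wave p x * (b x)^-1; pose Y x := b x * dwave p x - wave p x * beta x.
have ay : ac y (fun x => rho x * Y x).
  apply: ac_ext (acM aw (acV acb cbeta b0)) => // x xT.
  by rewrite /rho /Y; field; exact: b0.
have aY : ac Y (fun x => - (r ^+ 2 * rho x * y x)).
  apply: ac_ext (acB (acM acb adw) (acM aw acbeta)) => // x xT.
  by rewrite -(kappaE xT) /rho /y; field; exact: b0.
have acos : ac (fun x => cos (tau x)) (fun x => - sin (tau x) * (r * rho x)).
  apply: (ac_comp (h' := fun z => - sin z) atau ctau').
  by apply: ctsN; apply: cts_comp => // x _; exact: continuous_sin.
have asin : ac (fun x => sin (tau x)) (fun x => cos (tau x) * (r * rho x)).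
  apply: (ac_comp (h' := cos) atau ctau').
  by apply: cts_comp => // x _; exact: continuous_cos.
(* The Wronskian of y and sin tau is constant, and it is zero since both functions vanish at 0. *)
have aG : ac (fun x => r * (y x * cos (tau x)) - Y x * sin (tau x)) (fun=> 0).
  apply: ac_ext (acB (acZ r (acM ay acos)) (acM aY asin)) => // x _; ring.
have w0 : wave p 0 = 0 by rewrite /wave /= !mul0r sin0 !mulr0 addr0.
have G0 x : `[0, T]%classic x -> r * (y x * cos (tau x)) = Y x * sin (tau x).
  move=> xT; apply/eqP; rewrite -subr_eq0 (aG.2 x xT).
  rewrite /tau prim0 mulr0 sin0 /y w0 !mul0r !mulr0 subrr add0r prim_cst ?mul0r//.
  by move: xT; rewrite /= in_itv/= => /andP[].
have wT : wave p T = 0 by rewrite wave_T w0 oppr0.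
have tauT : 0 < tau T by rewrite mulr_gt0// prim_gt0.
(* At T the wave vanishes but its derivative does not, so the Wronskian leaves sin (tau T) = 0. *)
have sT : sin (tau T) = 0.
  have := G0 T itv0T_T; rewrite {1}/y {1}/Y wT !mul0r mulr0 subr0 => /esym/eqP.
  rewrite mulf_eq0 => /orP[|/eqP//].
  rewrite mulf_eq0 (negbTE (b0 T itv0T_T)) dwave_T oppr_eq0 /dwave /= !mul0r cos0.
  by rewrite add0r !mul1r invr_eq0 pnatr_eq0.
(* Otherwise tau reaches pi at some x inside the period, where the Wronskian gives y x = 0 although
   sin (x / 2) > 0. *)
have tau_le : tau T <= pi.
  rewrite leNgt; apply/negP => tpi.
  have tau0 : tau 0 = 0 by rewrite /tau prim0 mulr0.
  have [||x] := @IVT R tau 0 T pi (ltW T_gt0).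
  - exact: ctau.
  - rewrite tau0 ge_min le_max (ltW (pi_gt0 R)) (ltW tpi); by rewrite orbT.
  rewrite in_itv/= => /andP[x0 xT] tx.
  have xTT : `[0, T]%classic x by rewrite /= in_itv/= x0.
  have := G0 x xTT; rewrite tx cospi sinpi mulr0 mulrN1 mulrN => /eqP.
  rewrite oppr_eq0 mulf_eq0 (gt_eqF r_gt0)/= /y mulf_eq0 invr_eq0 (negbTE (b0 _ xTT)) orbF.
  rewrite /wave /= mul0r add0r mul1r gt_eqF//.
  apply: sin_gt0_pi; rewrite divr_gt0//=; last first.
    rewrite lt_neqAle x0 andbT; apply/eqP => E; move: tx; rewrite -E tau0 => /eqP.
    by rewrite lt_eqF// pi_gt0.
  have xlT : x < T.
    rewrite lt_neqAle xT andbT; apply/eqP => E; move: tpi; rewrite -E tx.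
    by rewrite ltxx.
  by rewrite ltr_pdivrMr// mulrC.
apply/eqP; rewrite eq_le tau_le /= leNgt; apply/negP => tpi.
by have := @sin_gt0_pi R (tau T); rewrite tauT tpi sT ltxx => /(_ isT).
Qed.
End constant_curvature.

(** * Reduction to Hill's equation *)

Section quadratic_forms.
Context {R : realType}.
Notation T := (2 * pi).

Lemma polar_angle (B C : R) : exists2 alpha : R, 0 <= alpha < T &
  B = Num.sqrt (B ^+ 2 + C ^+ 2) * cos alpha /\
  C = Num.sqrt (B ^+ 2 + C ^+ 2) * sin alpha.
Proof.
set D := Num.sqrt _; have pi0 := pi_gt0 R.
have BC0 : 0 <= B ^+ 2 + C ^+ 2 by rewrite addr_ge0 ?sqr_ge0.
have D2 : D ^+ 2 = B ^+ 2 + C ^+ 2 by rewrite sqr_sqrtr.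
have [D0|Dn0] := eqVneq D 0.
  exists 0; first by rewrite lexx T_gt0.
  have := sqr_ge0 B; have := sqr_ge0 C; rewrite D0 !mul0r => C0 B0.
  move: D2; rewrite D0 expr0n/= => E.
  by split; apply/eqP; rewrite -sqrf_eq0 eq_le; apply/andP; split=> //; lra.
have Dp : 0 < D by rewrite lt_def Dn0 sqrtr_ge0.
have h : (B / D) ^+ 2 + (C / D) ^+ 2 = 1.
  by rewrite !exprMn -mulrDl exprVn -D2 mulfV// sqrf_eq0.
have BD1 : -1 <= B / D <= 1.
  by rewrite -ler_norml -(@ler_pXn2r _ 2)// ?nnegrE// expr1n -normrX ger0_norm ?sqr_ge0//;
    have := sqr_ge0 (C / D); lra.
have BE : B = D * (B / D) by field.
have CE : C = D * (C / D) by field.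
have sa := sin_acos BD1; have ca := acosK BD1.
have a0 := acos_ge0 BD1; have a1 := acos_lepi BD1.
have E : 1 - (B / D) ^+ 2 = (C / D) ^+ 2 by lra.
rewrite E sqrtr_sqr in sa.
(* The values of acos cover [0, pi] only; for C < 0 the angle is reflected to 2 pi - acos (B /
   D). *)
have [C0|C0] := leP 0 C.
  exists (acos (B / D)); first by rewrite a0/=; lra.
  by rewrite ca sa ger0_norm ?divr_ge0 ?sqrtr_ge0.
have CD0 : C / D < 0 by rewrite pmulr_llt0// invr_gt0.
exists (T - acos (B / D)).
  rewrite subr_ge0 (le_trans a1)//=; last by lra.
  rewrite ltrBlDr ltrDl lt_def a0 andbT; apply/eqP => a00.
  by move: sa; rewrite a00 sin0 ltr0_norm//; lra.
rewrite cosB sinB (_ : T = pi *+ 2); last by rewrite mulr_natl.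
rewrite cos2pi sin2pi !mul1r !mul0r addr0 sub0r ca sa ltr0_norm//.
by rewrite opprK.
Qed.

Lemma cos_half (x : R) : cos (x / 2) ^+ 2 = (1 + cos x) / 2.
Proof.
have {2}-> : x = (x / 2) *+ 2 by rewrite -mulr_natl; field.
by rewrite cos_mulr2n -mulr_natl; field.
Qed.

Lemma sin_half (x : R) : sin (x / 2) ^+ 2 = (1 - cos x) / 2.
Proof. by rewrite sin2cos2 cos_half; field. Qed.

Lemma cos_sin_half (x : R) : cos (x / 2) * sin (x / 2) = sin x / 2.
Proof.
have {3}-> : x = (x / 2) *+ 2 by rewrite -mulr_natl; field.
by rewrite sin_mulr2n -mulr_natl; field.
Qed.

(* Writing the form as M + D cos (x - alpha), positivity at x = alpha +- pi gives D < M. *)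
Lemma wave_form (p q : R * R) :
  (forall x : R, `[0, T]%classic x -> 0 < wave p x ^+ 2 + wave q x ^+ 2) ->
  exists lambda d alpha : R, [/\ 0 < lambda, 0 < d, 0 <= alpha < T &
    forall x, wave p x ^+ 2 + wave q x ^+ 2 =
      d * (lambda ^+ 2 * cos ((x - alpha) / 2) ^+ 2 +
           lambda ^- 2 * sin ((x - alpha) / 2) ^+ 2)].
Proof.
move=> w0; case: p q w0 => [p1 p2] [q1 q2] w0.
pose P := p1 ^+ 2 + q1 ^+ 2; pose Q := p2 ^+ 2 + q2 ^+ 2.
pose M := (P + Q) / 2; pose B := (P - Q) / 2; pose C := p1 * p2 + q1 * q2.
have [alpha a01 [BE CE]] := polar_angle B C.
set D := Num.sqrt _ in BE CE; have pi0 := pi_gt0 R.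
have wE x : wave (p1, p2) x ^+ 2 + wave (q1, q2) x ^+ 2 = M + D * cos (x - alpha).
  rewrite cosB; transitivity (M + cos x * (D * cos alpha) + sin x * (D * sin alpha)).
    rewrite -BE -CE /wave /=.
    transitivity (P * cos (x / 2) ^+ 2 + Q * sin (x / 2) ^+ 2 +
      2 * C * (cos (x / 2) * sin (x / 2))); first by rewrite /P /Q /C; ring.
    by rewrite cos_half sin_half cos_sin_half /M /B; field.
  by ring.
have MD : 0 < M - D.
  have h x : cos (x - alpha) = -1 -> `[0, T]%classic x -> 0 < M - D.
    by move=> cx /w0; rewrite wE cx mulrN1.
  have [api|pia] := leP alpha pi.
    apply: (h (alpha + pi)); first by rewrite addrAC subrr add0r cospi.
    by rewrite /= in_itv/=; lra.
  apply: (h (alpha - pi)); first by rewrite addrAC subrr add0r cosN cospi.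
  by rewrite /= in_itv/=; lra.
have D0 : 0 <= D by exact: sqrtr_ge0.
have MD' : 0 < M + D by lra.
(* The choice lambda^2 = a / e and d = a e gives d lambda^2 = M + D and d lambda^-2 = M - D. *)
pose a := Num.sqrt (M + D); pose e := Num.sqrt (M - D).
have a0 : 0 < a by rewrite sqrtr_gt0. have e0 : 0 < e by rewrite sqrtr_gt0.
have aE : a ^+ 2 = M + D by rewrite sqr_sqrtr// ltW.
have eE : e ^+ 2 = M - D by rewrite sqr_sqrtr// ltW.
exists (Num.sqrt (a / e)), (a * e), alpha; split => //.
- by rewrite sqrtr_gt0 divr_gt0.
- by rewrite mulr_gt0.
move=> x; rewrite wE sqr_sqrtr; last by rewrite ltW// divr_gt0.
have -> : a * e * (a / e * cos ((x - alpha) / 2) ^+ 2 +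
    (a / e)^-1 * sin ((x - alpha) / 2) ^+ 2) =
    a ^+ 2 * cos ((x - alpha) / 2) ^+ 2 + e ^+ 2 * sin ((x - alpha) / 2) ^+ 2.
  by field; rewrite !gt_eqF.
by rewrite aE eE cos_half sin_half; field.
Qed.
End quadratic_forms.

(** * The cube root of u and the scaled inequality *)

Section cube_root.
Context {R : realType}.
Notation T := (2 * pi).

(* The integrands differ by the derivative of 12 b^3 beta^3 - (9/2) b^5 beta. *)
Lemma energy_factorization (b beta gamma : R -> R) : ac b beta -> ac beta gamma ->
  L2 gamma -> b T = b 0 -> beta T = beta 0 ->
  prim (fun x => (3 * b x ^+ 2 * gamma x + 6 * b x * beta x ^+ 2) ^+ 2 -
    5 / 2 * (3 * b x ^+ 2 * beta x) ^+ 2 + 9 / 16 * (b x ^+ 3) ^+ 2) T =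
  9 * prim (fun x => (b x ^+ 2 * (gamma x + b x / 4)) ^+ 2) T.
Proof.
move=> ab abeta Lg bT betaT; have cb := ac_cts ab; have cbeta := ac_cts abeta.
have ab2 := acM ab ab; have ab3 := acM ab ab2; have ab5 := acM ab3 ab2.
have abe3 := acM abeta (acM abeta abeta).
have aD := acB (acZ 12 (acM ab3 abe3)) (acZ (9 / 2) (acM ab5 abeta)).
have := ac_prim_T aD; rewrite bT betaT subrr => E.
have Lk : L2 (fun x => b x ^+ 2 * (gamma x + b x / 4)).
  apply: L2_ctsM; first exact: ctsX.
  by apply: L2D => //; apply: L2_cts; apply: ctsM => //; exact: cts_cst.
rewrite -primZ//; last exact: L2_intg_sq.
rewrite -[RHS]addr0 -E -primD//; [|by apply: intgZ; exact: L2_intg_sq|exact: aD.1].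
by apply: eq_prim => // x _; field.
Qed.

Lemma powR_third_expr3 (x : R) : 0 <= x -> (x `^ (1 / 3)) ^+ 3 = x.
Proof.
move=> x0; rewrite -powR_mulrn ?powR_ge0// -powRrM.
by rewrite (_ : 1 / 3 * 3%:R = 1) ?powRr1//; field.
Qed.

Lemma powR_third_inv (x : R) : 0 <= x -> x `^ (- (2 / 3)) = (x `^ (1 / 3))^-1 ^+ 2.
Proof.
move=> x0; rewrite exprVn -powR_mulrn ?powR_ge0// -powRrM -powRN.
by congr (_ `^ _); field.
Qed.

(** Positivity makes b = u^(1/3) as regular as [u]: b' = W / (3 b^2) is absolutely continuous and
    b'' is square integrable. *)
Lemma ac_cube_root (u W u2 : R -> R) : (forall x, 0 < u x) -> ac u W -> ac W u2 -> L2 u2 ->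
  u T = u 0 -> W T = W 0 ->
  let b x := u x `^ (1 / 3) in
  exists beta kappa : R -> R,
    [/\ ac b beta, ac beta (fun x => kappa x - b x / 4), L2 kappa,
        b T = b 0 /\ beta T = beta 0 &
    prim (fun x => u2 x ^+ 2 - 5 / 2 * W x ^+ 2 + 9 / 16 * u x ^+ 2) T =
    9 * prim (fun x => (b x ^+ 2 * kappa x) ^+ 2) T].
Proof.
move=> u0 au aW L2u uT WT b; have cu := ac_cts au; have cW := ac_cts aW.
have b0 x : 0 < b x by rewrite powR_gt0.
have bn0 x : b x != 0 by rewrite gt_eqF.
have b3 x : b x ^+ 3 = u x by rewrite powR_third_expr3// ltW.
have cb : cts b.
  apply: (cts_comp (h := fun y => y `^ (1 / 3))) => // x xT.
  apply/differentiable_continuous/derivable1_diffP.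
  by apply: derivable_powR; rewrite in_itv/= u0.
have cib : cts (fun x => (b x)^-1) by exact: ctsV.
have dE x : 1 / 3 * u x `^ (1 / 3 - 1) = 1 / 3 * (b x)^-1 ^+ 2.
  rewrite -powR_third_inv; last exact/ltW.
  by congr (_ * _ `^ _); field.
have cd : cts (fun x => 1 / 3 * (b x)^-1 ^+ 2) by solve_cts.
pose beta x := 1 / 3 * (b x)^-1 ^+ 2 * W x.
have ab : ac b beta.
  apply: (ac_ext _ _ (ac_comp (h := fun y => y `^ (1 / 3))
    (h' := fun y => 1 / 3 * y `^ (1 / 3 - 1)) au cW _ _)) => //.
  - by move=> x _; rewrite /beta /= dE.
  - by move=> x _; apply: is_derive1_powR.
  - by apply: cts_ext cd => x _; rewrite dE.
have cbeta : cts beta by rewrite /beta; solve_cts.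
have aib := acV ab cbeta (fun x _ => bn0 x).
have abeta0 := acM (acZ (1 / 3) (acM aib aib)) aW.
(* This is b'', solved from u'' = 3 b^2 b'' + 6 b b'^2. *)
pose gamma x := 1 / 3 * (b x)^-1 ^+ 2 * u2 x - 2 * (b x)^-1 * beta x ^+ 2.
have abeta : ac beta gamma.
  apply: ac_ext abeta0 => x _; first by rewrite /beta.
  by rewrite /gamma /beta; field.
have Lg : L2 gamma.
  by apply: L2B; [exact: L2_ctsM|apply: L2_cts; solve_cts].
have cb4 : cts (fun x => b x / 4) by solve_cts.
have bT : b T = b 0 by rewrite /b uT.
have betaT : beta T = beta 0 by rewrite /beta WT bT.
exists beta, (fun x => gamma x + b x / 4); split => //.
- by apply: ac_ext abeta => // x _; rewrite addrK.
- by apply: L2D => //; exact: L2_cts.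
rewrite -(energy_factorization ab abeta Lg bT betaT); apply: eq_prim => // x _.
rewrite b3 /gamma /beta; congr (_ ^+ 2 - _ * _ ^+ 2 + _); by field.
Qed.

(* c is the constant for which c * b has conformal length pi; the product of
   the two integrals is invariant under this scaling. *)
Lemma cube_root_inequality (b beta kappa : R -> R) :
  (forall x, `[0, T]%classic x -> 0 < b x) -> ac b beta ->
  ac beta (fun x => kappa x - b x / 4) -> L2 kappa -> b T = b 0 -> beta T = beta 0 ->
  let F := prim (fun x => (b x ^+ 2 * kappa x) ^+ 2) T *
    prim (fun x => (b x)^-1 ^+ 2) T ^+ 3 in
  pi ^+ 4 <= F /\ (F = pi ^+ 4 -> exists p q : R * R,
    forall x, `[0, T]%classic x -> b x ^+ 2 = wave p x ^+ 2 + wave q x ^+ 2).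
Proof.
move=> b0 ab abeta Lk bT betaT; set J := prim _ T; set L := prim _ T => F; have pi0 := pi_gt0 R.
have bn0 x : `[0, T]%classic x -> b x != 0 by move=> xT; rewrite gt_eqF// b0.
have cb := ac_cts ab.
have crho : cts (fun x => (b x)^-1 ^+ 2) by apply: ctsX; exact: ctsV.
have L0 : 0 < L by apply: prim_gt0 => // x xT; rewrite exprn_gt0// invr_gt0 b0.
pose c := Num.sqrt (L / pi); have c0 : 0 < c by rewrite sqrtr_gt0 divr_gt0.
have c2 : c ^+ 2 = L / pi by rewrite sqr_sqrtr// ltW// divr_gt0.
have cn0 : c != 0 by rewrite gt_eqF.
have Lbk : L2 (fun x => b x ^+ 2 * kappa x) by apply: L2_ctsM => //; exact: ctsX.
have JE : prim (fun x => ((c * b x) ^+ 2 * (c * kappa x)) ^+ 2) T = J * L ^+ 3 / pi ^+ 3.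
  transitivity (c ^+ 6 * J); last first.
    by rewrite (exprM c 2 3) c2 expr_div_n; ring.
  rewrite -primZ//; last exact: L2_intg_sq.
  by apply: eq_prim => // x _; ring.
have rig := @hill_rigidity R (fun x => c * b x) (fun x => c * beta x) (fun x => c * kappa x).
rewrite JE in rig.
have {}rig : J * L ^+ 3 / pi ^+ 3 <= pi -> J * L ^+ 3 / pi ^+ 3 = pi /\
    exists p q : R * R, forall x, `[0, T]%classic x ->
      (c * b x) ^+ 2 = wave p x ^+ 2 + wave q x ^+ 2.
  apply: rig.
  - by move=> x xT; rewrite mulr_gt0// b0.
  - exact: acZ.
  - by apply: ac_ext (acZ c abeta) => // x _; ring.
  - by apply: L2_ctsM => //; exact: cts_cst.
  - by rewrite bT.
  - by rewrite betaT.
  - transitivity (prim (fun x => c ^- 2 * (b x)^-1 ^+ 2) T).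
      by apply: eq_prim => // x xT; field; rewrite cn0 bn0.
    rewrite primZ//; last exact: cts_intg.
    by rewrite c2 -/L invf_div divfK// gt_eqF.
have FE : F = J * L ^+ 3 / pi ^+ 3 * pi ^+ 3 by rewrite divfK// expf_neq0// gt_eqF.
have p4 : pi ^+ 4 = pi * pi ^+ 3 :> R by rewrite exprS.
split.
  rewrite FE p4 ler_pM2r ?exprn_gt0//; have [/rig[-> _]//|/ltW//] := leP (J * L ^+ 3 / pi ^+ 3) pi.
rewrite FE p4 => /mulIf E; have {}E := E (expf_neq0 _ (lt0r_neq0 pi0)).
have [|_ [p [q pq]]] := rig; first by rewrite E.
exists (c^-1 * p.1, c^-1 * p.2), (c^-1 * q.1, c^-1 * q.2) => x xT.
have -> : b x ^+ 2 = c^-1 ^+ 2 * (c * b x) ^+ 2 by field.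
by rewrite pq// /wave /=; ring.
Qed.
End cube_root.

(** * Evaluation at the extremals and extension by periodicity *)

Section equality_case.
Context {R : realType}.
Notation T := (2 * pi).

(** Differentiating b^2 twice shows that b^3 kappa is the constant A B / 4 = r^2. The first integral
    is then r^4 times the second, and r times the second is pi. *)
Lemma extremal_value (b beta kappa : R -> R) (A B r alpha : R) :
  (forall x, `[0, T]%classic x -> 0 < b x) -> ac b beta ->
  ac beta (fun x => kappa x - b x / 4) -> L2 kappa -> 0 < r -> r ^+ 2 = A * B / 4 ->
  (forall x, `[0, T]%classic x ->
    b x ^+ 2 = A * cos ((x - alpha) / 2) ^+ 2 + B * sin ((x - alpha) / 2) ^+ 2) ->
  prim (fun x => (b x ^+ 2 * kappa x) ^+ 2) T *
    prim (fun x => (b x)^-1 ^+ 2) T ^+ 3 = pi ^+ 4.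
Proof.
move=> b0 ab abeta Lk r0 r2 bE.
have bn0 x : `[0, T]%classic x -> b x != 0 by move=> xT; rewrite gt_eqF// b0.
have cb := ac_cts ab; have cbeta := ac_cts abeta.
have cib : cts (fun x => (b x)^-1) by exact: ctsV.
pose M := (A + B) / 2; pose D := (A - B) / 2.
have bE' x : `[0, T]%classic x -> b x ^+ 2 = M + D * cos (1 * (x - alpha)).
  by move=> xT; rewrite bE// cos_half sin_half mul1r /M /D; field.
have ctrig : cts (fun x => cos (1 * (x - alpha))) /\ cts (fun x => sin (1 * (x - alpha))).
  split; apply: continuous_cts => x; apply/differentiable_continuous/derivable1_diffP.
    by have [] := is_derive_cosk 1 alpha x.
  by have [] := is_derive_sink 1 alpha x.
have [ccos csin] := ctrig.
have acosk : ac (fun x => cos (1 * (x - alpha))) (fun x => - (1 * sin (1 * (x - alpha)))).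
  by apply: ac_FTC => //; [solve_cts|move=> x _; exact: is_derive_cosk].
have asink : ac (fun x => sin (1 * (x - alpha))) (fun x => 1 * cos (1 * (x - alpha))).
  by apply: ac_FTC => //; [solve_cts|move=> x _; exact: is_derive_sink].
pose dw x := - D * sin (1 * (x - alpha)).
have aw : ac (fun x => b x * b x) dw.
  apply: ac_ext (acD (ac_cst M) (acZ D acosk)) => x xT; last by rewrite /dw; ring.
  by rewrite -expr2 bE'.
have cdw : cts dw by rewrite /dw; solve_cts.
have a2 := acM ab ab.
have dwE x : `[0, T]%classic x -> beta x * b x + b x * beta x = dw x.
  by apply: (ac_cts_unique a2 aw) => //; solve_cts.
have adw : ac dw (fun x => - D * cos (1 * (x - alpha))).
  by apply: ac_ext (acZ (- D) asink) => // x _; rewrite mul1r.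
have a2' := acD (acM abeta ab) (acM ab abeta).
have adw' := ac_ext dwE (fun x _ => erefl) a2'.
have ddw := ac_aeq_unique adw' adw.
(* The identity for second derivatives holds only almost everywhere; [kappa1] is the continuous
   representative, for which b^3 kappa1 = r^2 at every point of the period, as
   [constant_curvature_length] requires. *)
pose kappa1 x := r ^+ 2 * (b x)^-1 ^+ 3.
have ck1 : cts kappa1 by rewrite /kappa1; solve_cts.
have kk : aeq kappa kappa1.
  apply: (@filterS _ _ (ae_filter_ringOfSetsType _) _ _ _ ddw) => x H xT.
  have h1 := H xT; have h2 := dwE x xT; have h3 := bE' x xT; have bx := bn0 x xT.
  have E : b x ^+ 3 * kappa x = r ^+ 2.
    have h4 : 2 * b x * kappa x = - D * cos (1 * (x - alpha)) - 2 * beta x ^+ 2 + b x ^+ 2 / 2.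
      by rewrite -h1; field.
    have h5 : (2 * (b x * beta x)) ^+ 2 = dw x ^+ 2 by rewrite -h2; congr (_ ^+ 2); ring.
    have -> : b x ^+ 3 * kappa x = b x ^+ 2 * (2 * b x * kappa x) / 2 by field.
    rewrite h4.
    have -> : b x ^+ 2 * (- D * cos (1 * (x - alpha)) - 2 * beta x ^+ 2 + b x ^+ 2 / 2) / 2 =
      (b x ^+ 2 * (- D * cos (1 * (x - alpha)) + b x ^+ 2 / 2)) / 2 -
      (2 * (b x * beta x)) ^+ 2 / 4 by field.
    rewrite h5 h3 r2 /dw exprMn sqrrN.
    have -> : sin (1 * (x - alpha)) ^+ 2 = 1 - cos (1 * (x - alpha)) ^+ 2 by rewrite sin2cos2.
    by rewrite /M /D; field.
  by rewrite /kappa1 -E; field.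
have cb4 : cts (fun x => b x / 4) by solve_cts.
have abeta1 : ac beta (fun x => kappa1 x - b x / 4).
  apply: (ac_aeq _ _ abeta); first by apply/cts_intg/ctsB.
  by apply: (@filterS _ _ (ae_filter_ringOfSetsType _) _ _ _ kk) => x H xT; rewrite H.
have len := constant_curvature_length b0 ab abeta1 r0.
have {}len : r * prim (fun x => (b x)^-1 ^+ 2) T = pi.
  by apply: len => x xT; rewrite /kappa1; field; exact: bn0.
have -> : prim (fun x => (b x ^+ 2 * kappa x) ^+ 2) T =
    r ^+ 4 * prim (fun x => (b x)^-1 ^+ 2) T.
  transitivity (prim (fun x => (b x ^+ 2 * kappa1 x) ^+ 2) T).
    apply: aeq_prim; first by apply/L2_intg_sq/L2_ctsM => //; exact: ctsX.
      by apply: cts_intg; solve_cts.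
    apply: (@filterS _ _ (ae_filter_ringOfSetsType _) _ _ _ kk) => x H xT.
    by rewrite H.
  rewrite -primZ//; last by apply: cts_intg; solve_cts.
  by apply: eq_prim => // x xT; rewrite /kappa1; field; exact: bn0.
by rewrite -[in RHS]len; ring.
Qed.

Lemma periodic_eq (f g : R -> R) : periodic f T -> periodic g T ->
  (forall x, `[0, T]%classic x -> f x = g x) -> f = g.
Proof.
move=> pf pg fg; apply/funext => x; have T0 := @T_gt0 R.
(* Shifts are by natural multiples of the period: first up to a nonnegative point, then back down
   into [0, T]. *)
have [k xk] : exists k : nat, 0 <= x + T *+ k.
  exists (Num.truncn (`|x| / T)).+1; rewrite -mulr_natr.
  have : `|x| / T < (Num.truncn (`|x| / T)).+1%:R by exact: truncnS_gt.
  rewrite ltr_pdivrMr// mulrC => h; have := ler_norm (- x); rewrite normrN; lra.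
set y := x + T *+ k in xk.
have j1 : (Num.truncn (y / T))%:R <= y / T by rewrite truncn_le// divr_ge0// ltW.
have j2 : y / T < (Num.truncn (y / T)).+1%:R by exact: truncnS_gt.
set j := Num.truncn _ in j1 j2; pose z := y - T *+ j.
have yE : y = z + T *+ j by rewrite /z subrK.
have -> : f x = f z by rewrite -(periodicn pf k) -/y yE periodicn.
have -> : g x = g z by rewrite -(periodicn pg k) -/y yE periodicn.
apply: fg; rewrite /= in_itv/= /z -mulr_natr.
move: j1 j2; rewrite ler_pdivlMr// ltr_pdivrMr// -natr1; lra.
Qed.
End equality_case.

(** * The sharp inequality and its extremals *)

Theorem theorem4 (R : realType) (u u1 u2 : R -> R)
    (hu : sobolev_H2 u u1 u2) (hpos : forall theta : R, 0 < u theta) :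
  let F : R :=
    (\int[@lebesgue_measure R]_(theta in `[0%R, (2 * pi)%R])
        (u2 theta ^+ 2 - 5 / 2 * u1 theta ^+ 2 + 9 / 16 * u theta ^+ 2)) *
    (\int[@lebesgue_measure R]_(theta in `[0%R, (2 * pi)%R])
        (u theta `^ (- (2 / 3)))) ^+ 3 in
  9 * pi ^+ 4 <= F /\
  (F = 9 * pi ^+ 4 <->
   exists lambda c alpha : R,
     [/\ 0 < lambda, 0 < c, 0 <= alpha < 2 * pi &
      forall theta : R,
        u theta = c * (lambda ^+ 2 * cos ((theta - alpha) / 2) ^+ 2 +
                       lambda ^- 2 * sin ((theta - alpha) / 2) ^+ 2) `^ (3 / 2)]).
Proof.
move=> F; have pi0 := pi_gt0 R.
have [W [au aW uT WT u1W]] := sobolev_H2_ac hu.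
have [[cu [pu _ _] L1 L2u'] _] := hu.
have L1' : L2 u1 by case: L1. have L2u : L2 u2 by case: L2u'.
have ctu : cts u by exact: continuous_cts.
have cW := ac_cts aW.
pose b x := u x `^ (1 / 3).
have [beta [kappa [ab abeta Lk [bT betaT] energy]]] := ac_cube_root hpos au aW L2u uT WT.
rewrite -/b in ab abeta bT energy.
have b0 x : 0 < b x by rewrite powR_gt0.
have b3 x : b x ^+ 3 = u x by rewrite powR_third_expr3// ltW.
pose J := prim (fun x => (b x ^+ 2 * kappa x) ^+ 2) (2 * pi).
pose L := prim (fun x => (b x)^-1 ^+ 2) (2 * pi).
(* [u1] is replaced by its continuous representative [W], and u^(-2/3) is b^-2. *)
have FE : F = 9 * (J * L ^+ 3).
  rewrite mulrA -[9 * J]energy; congr (_ * _ ^+ 3).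
    have ctu2 : L2 u by exact: L2_cts. have LW : L2 W by exact: L2_cts.
    apply: aeq_prim.
    - apply: intgD; [apply: intgB; [|apply: intgZ]|apply: intgZ]; exact: L2_intg_sq.
    - apply: intgD; [apply: intgB; [|apply: intgZ]|apply: intgZ]; exact: L2_intg_sq.
    - apply: (@filterS _ _ (ae_filter_ringOfSetsType _) _ _ _ u1W) => x H xT.
      by rewrite H.
  by apply: eq_prim => // x _; rewrite powR_third_inv// ltW.
have [ineq rig] := cube_root_inequality (fun x _ => b0 x) ab abeta Lk bT betaT.
rewrite -/J -/L in ineq rig.
have F9 : (F = 9 * pi ^+ 4) <-> (J * L ^+ 3 = pi ^+ 4).
  by rewrite FE; split => [/mulfI -> //|->].
split; first by rewrite FE ler_pM2l.
split=> [/F9 /rig[p [q pq]]|[lambda [c [alpha [l0 c0 a01 uE]]]]].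
  have [|lambda [d [alpha [l0 d0 a01 wE]]]] := @wave_form R p q.
    by move=> x xT; rewrite -pq// exprn_gt0.
  exists lambda, (d `^ (3 / 2)), alpha; split => //; first exact: powR_gt0.
  pose X x := lambda ^+ 2 * cos ((x - alpha) / 2) ^+ 2 +
    lambda ^- 2 * sin ((x - alpha) / 2) ^+ 2.
  have X0 x : 0 <= X x.
    by rewrite addr_ge0// mulr_ge0 ?sqr_ge0// invr_ge0 sqr_ge0.
  (* The formula for u comes from an identity on one period and has to be extended. Shifting the
     half angle by pi only changes signs inside squares, so both sides have period 2 pi. *)
  have Xper : periodic X (2 * pi).
    move=> x; rewrite /X (_ : (x + 2 * pi - alpha) / 2 = (x - alpha) / 2 + pi); last by field.
    by rewrite cosDpi sinDpi !sqrrN.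
  have := @periodic_eq R u (fun x => d `^ (3 / 2) * X x `^ (3 / 2)) pu.
  move=> H; have {}H := H _ _; suff -> : u = (fun x => d `^ (3 / 2) * X x `^ (3 / 2)) by [].
  apply: H; first by move=> x; rewrite Xper.
  move=> x xT; rewrite -powRM//; last exact: ltW.
  rewrite -wE -pq//; have bx : 0 <= b x by rewrite ltW.
  rewrite -[LHS]b3 -(powR_mulrn 3 bx) -(powR_mulrn 2 bx) -powRrM.
  by congr (_ `^ _); field.
(* As b^2 = u^(2/3), the factor c becomes k = c^(2/3). With A = k lambda^2 and B = k lambda^-2, the
   condition r^2 = A B / 4 gives r = k / 2. *)
apply/F9; pose k := c `^ (2 / 3).
have k0 : 0 < k by exact: powR_gt0.
apply: (@extremal_value R b beta kappa (k * lambda ^+ 2) (k * lambda ^- 2) (k / 2) alpha) => //.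
- by rewrite divr_gt0.
- by field; rewrite gt_eqF.
move=> x _; set X := _ + _ .
have -> : X = k * (lambda ^+ 2 * cos ((x - alpha) / 2) ^+ 2 +
    lambda ^- 2 * sin ((x - alpha) / 2) ^+ 2) by rewrite /X; ring.
set Y := _ + _; have Y0 : 0 <= Y by rewrite addr_ge0// mulr_ge0 ?sqr_ge0// invr_ge0 sqr_ge0.
rewrite /b uE -/Y -powR_mulrn ?powR_ge0// -powRrM powRM ?powR_ge0 ?ltW//.
rewrite -powRrM; congr (_ * _); first by rewrite /k; congr (_ `^ _); field.
by rewrite -[RHS]powRr1//; congr (_ `^ _); field.
Qed.
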